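(* For every bound quiver algebra $\Lambda=kQ/I$, it holds that $$\mathsf{Fin.dim}\,\Lambda\le \mathsf{id}\,{}_\Lambda\big(\Lambda f_{\mathsf{n.m}}/J(\Lambda)f_{\mathsf{n.m}}\big).$$ In particular, if $\Lambda$ has quasi-uniform Loewy length, then $\mathsf{Fin.dim}\,\Lambda$ is finite and bounded above by $\mathsf{fin.dim}\,\Lambda^{\mathrm{op}}$.
   Context: A bound quiver algebra is $\Lambda=kQ/I$ with $k$ a field, $Q$ a finite quiver and $I$ an admissible ideal of $kQ$. For paths $p,q$, $pq$ denotes $p$ followed by $q$. $e_i$ is the trivial path at the vertex $i$; modules are left modules; $J(\Lambda)$ is the Jacobson radical. The Loewy length of a module $M$ is the least $t\ge0$ with $J(\Lambda)^tM=0$, the Loewy length of $\Lambda$ is that of ${}_\Lambda\Lambda$, and the Loewy length of a module is maximal if it equals that of $\Lambda$. $f_{\mathsf{n.m}}$ is the sum of all $e_i$ such that $\Lambda e_i$ has non-maximal Loewy length, so $\Lambda f_{\mathsf{n.m}}/J(\Lambda)f_{\mathsf{n.m}}$ is the top of $\Lambda f_{\mathsf{n.m}}$. $\Lambda$ has quasi-uniform Loewy length (from the left) if every indecomposable projective left $\Lambda$-module whose top has infinite injective dimension has maximal Loewy length. $\mathsf{id}$ is injective dimension, with the injective dimension of the zero module taken to be $0$. $\mathsf{Fin.dim}\,R$ (resp. $\mathsf{fin.dim}\,R$) is the supremum of the projective dimensions of all (resp. finitely generated) left $R$-modules of finite projective dimension. *)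

(* Defs.v *)
From HB Require Import structures.
From mathcomp Require Import all_boot all_algebra generic_quotient ring_quotient.
From mathcomp Require Import boolp classical_sets functions.

Set Implicit Arguments.
Unset Strict Implicit.
Unset Printing Implicit Defensive.

Import GRing.Theory.
Local Open Scope ring_scope.
Local Open Scope quotient_scope.
Local Open Scope classical_set_scope.

(* Lengths and dimensions are extended naturals: [None] is infinity. *)
Definition enat := option nat.

Definition le_enat (a b : enat) : Prop :=
  match a, b with
  | _, None => True
  | None, Some _ => False
  | Some m, Some n => (m <= n)%N
  end.

Definition least (P : nat -> Prop) : enat :=
  if pselect (exists n, `[< P n >]) is left h then Some (ex_minn h) else None.

(* Modules are left modules, [lmodType R]; submodules are the [submodClosed]
   predicates of the library. *)
Section Modules.
Variables (R : pzRingType) (M : lmodType R) (U : submodClosed M).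

Definition submod := {x : M | x \in U}.
HB.instance Definition _ := SubChoice.on submod.
HB.instance Definition _ := [SubChoice_isSubLmodule of submod by <:].

(* [submodClosed] also serves modules over semirings, so the library does not
   infer from it the closure under opposites that [ideal_quot] requires. *)
Definition submod_pred : {pred M} := fun x => x \in U.

Fact submod_pred_zmod_closed : zmod_closed submod_pred.
Proof. exact: GRing.submod_closedB (submodClosedP U). Qed.
HB.instance Definition _ := GRing.isZmodClosed.Build M submod_pred
  submod_pred_zmod_closed.

Definition quot_mod := {ideal_quot submod_pred}.
HB.instance Definition _ := GRing.Zmodule.on quot_mod.

Definition quot_mod_proj (x : M) : quot_mod := \pi_({ideal_quot submod_pred}) x.

Definition quot_scale (a : R) (x : quot_mod) : quot_mod :=
  quot_mod_proj (a *: repr x).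

Lemma quot_mod_projK (x : quot_mod) : quot_mod_proj (repr x) = x.
Proof. exact: reprK. Qed.

Lemma quot_mod_projD x y :
  quot_mod_proj (x + y) = quot_mod_proj x + quot_mod_proj y.
Proof. exact: raddfD. Qed.

Lemma quot_mod_proj_eq x y :
  (quot_mod_proj x == quot_mod_proj y) = (x - y \in U).
Proof. by rewrite -Quotient.idealrBE. Qed.

Lemma quot_mod_projZ a x :
  quot_scale a (quot_mod_proj x) = quot_mod_proj (a *: x).
Proof.
apply/eqP; rewrite quot_mod_proj_eq -scalerBr rpredZ //.
by rewrite -quot_mod_proj_eq quot_mod_projK.
Qed.

Fact quot_scalerA a b x :
  quot_scale a (quot_scale b x) = quot_scale (a * b) x.
Proof. by rewrite -[x]quot_mod_projK !quot_mod_projZ scalerA. Qed.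

Fact quot_scale1r : left_id 1 quot_scale.
Proof. by move=> x; rewrite -[x]quot_mod_projK quot_mod_projZ scale1r. Qed.

Fact quot_scalerDr : right_distributive quot_scale +%R.
Proof.
move=> a x y; rewrite -[x]quot_mod_projK -[y]quot_mod_projK.
by rewrite -quot_mod_projD !quot_mod_projZ scalerDr quot_mod_projD.
Qed.

Fact quot_scalerDl x : {morph quot_scale^~ x : a b / a + b}.
Proof.
move=> a b; rewrite -[x]quot_mod_projK !quot_mod_projZ.
by rewrite scalerDl quot_mod_projD.
Qed.

HB.instance Definition _ := GRing.Zmodule_isLmodule.Build R quot_mod
  quot_scalerA quot_scale1r quot_scalerDr quot_scalerDl.
End Modules.

HB.mixin Record isTwoSidedIdeal (R : pzRingType) (S : R -> bool) := {
  ideal_mull : forall a, {in S, forall x, a * x \in S};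
  ideal_mulr : forall a, {in S, forall x, x * a \in S}
}.

#[short(type="ideal")]
HB.structure Definition TwoSidedIdeal (R : pzRingType) :=
  {S of GRing.ZmodClosed R S & isTwoSidedIdeal R S}.

Section QuotientRing.
Variables (R : pzRingType) (I : ideal R).

Definition quot_ring := {ideal_quot I}.
HB.instance Definition _ := GRing.Zmodule.on quot_ring.

Definition quot_proj (x : R) : quot_ring := \pi_({ideal_quot I}) x.

Definition quot_mul (x y : quot_ring) : quot_ring :=
  quot_proj (repr x * repr y).

Lemma quot_projK (x : quot_ring) : quot_proj (repr x) = x.
Proof. exact: reprK. Qed.

Lemma quot_projD x y : quot_proj (x + y) = quot_proj x + quot_proj y.
Proof. exact: raddfD. Qed.

Lemma quot_proj_eq x y : (quot_proj x == quot_proj y) = (x - y \in I).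
Proof. by rewrite Quotient.idealrBE. Qed.

Lemma quot_projM x y : quot_mul (quot_proj x) (quot_proj y) = quot_proj (x * y).
Proof.
apply/eqP; rewrite /quot_mul quot_proj_eq.
set x' := repr _; set y' := repr _.
have -> : x' * y' - x * y = x' * (y' - y) + (x' - x) * y.
  by rewrite mulrBr mulrBl addrA subrK.
apply: rpredD; [apply: ideal_mull | apply: ideal_mulr];
  by rewrite -quot_proj_eq quot_projK.
Qed.

Fact quot_mulA : associative quot_mul.
Proof.
move=> x y z; rewrite -[x]quot_projK -[y]quot_projK -[z]quot_projK.
by rewrite !quot_projM mulrA.
Qed.

Fact quot_mul1 : left_id (quot_proj 1) quot_mul.
Proof. by move=> x; rewrite -[x]quot_projK quot_projM mul1r. Qed.

Fact quot_1mul : right_id (quot_proj 1) quot_mul.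
Proof. by move=> x; rewrite -[x]quot_projK quot_projM mulr1. Qed.

Fact quot_mulDl : left_distributive quot_mul +%R.
Proof.
move=> x y z; rewrite -[x]quot_projK -[y]quot_projK -[z]quot_projK.
by rewrite -quot_projD !quot_projM -quot_projD mulrDl.
Qed.

Fact quot_mulDr : right_distributive quot_mul +%R.
Proof.
move=> x y z; rewrite -[x]quot_projK -[y]quot_projK -[z]quot_projK.
by rewrite -quot_projD !quot_projM -quot_projD mulrDr.
Qed.

HB.instance Definition _ := GRing.Zmodule_isPzRing.Build quot_ring
  quot_mulA quot_mul1 quot_1mul quot_mulDl quot_mulDr.
End QuotientRing.

Section Dimensions.
Variable R : pzRingType.
Implicit Types M P E : lmodType R.

Definition projective P : Prop :=
  forall (A B : lmodType R) (g : {linear A -> B}) (f : {linear P -> B}),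
    (forall b, exists a, g a = b) ->
    exists h : {linear P -> A}, forall x, g (h x) = f x.

Definition injective_mod E : Prop :=
  forall (A B : lmodType R) (g : {linear A -> B}) (f : {linear A -> E}),
    injective g -> exists h : {linear B -> E}, forall x, h (g x) = f x.

Definition zero_mod M : Prop := forall x : M, x = 0.

Definition exact_at (A B C : lmodType R) (f : {linear A -> B})
    (g : {linear B -> C}) : Prop :=
  forall y, g y = 0 <-> exists x, f x = y.

Definition has_proj_resolution M (n : nat) : Prop :=
  exists (P : nat -> lmodType R) (d : forall i, {linear P i.+1 -> P i})
      (eps : {linear P 0 -> M}),
    [/\ forall i, projective (P i),
        forall i, (n < i)%N -> zero_mod (P i),
        forall x, exists y, eps y = x,
        exact_at (d 0) eps
      & forall i, exact_at (d i.+1) (d i)].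

Definition has_inj_resolution M (n : nat) : Prop :=
  exists (E : nat -> lmodType R) (d : forall i, {linear E i -> E i.+1})
      (eta : {linear M -> E 0}),
    [/\ forall i, injective_mod (E i),
        forall i, (n < i)%N -> zero_mod (E i),
        injective eta,
        exact_at eta (d 0)
      & forall i, exact_at (d i) (d i.+1)].

Definition projdim M : enat := least (has_proj_resolution M).
Definition injdim M : enat := least (has_inj_resolution M).

Definition finitely_generated M : Prop :=
  exists (n : nat) (g : 'I_n -> M),
    forall x, exists c : 'I_n -> R, x = \sum_i c i *: g i.

(* The supremum is taken in the extended naturals. *)
Definition big_findim : enat :=
  least (fun d => forall M, projdim M <> None -> le_enat (projdim M) (Some d)).

Definition small_findim : enat :=
  least (fun d => forall M, finitely_generated M -> projdim M <> None ->
                            le_enat (projdim M) (Some d)).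

Definition indecomposable M : Prop :=
  ~ zero_mod M /\
  forall U V : submodClosed M,
    (forall x, x \in U -> x \in V -> x = 0) ->
    (forall x, exists u v, [/\ u \in U, v \in V & x = u + v]) ->
    (forall x, x \in U -> x = 0) \/ (forall x, x \in V -> x = 0).
End Dimensions.

Section Loewy.
Variable R : pzRingType.

(* Finite sums of products; this is [A B] for an ideal [A] and a submodule
   [B], and the product of ideals when [M] is [R^o]. *)
Definition mul_set (M : lmodType R) (A : set R) (B : set M) : set M :=
  [set v | exists (n : nat) (a : 'I_n -> R) (x : 'I_n -> M),
     [/\ forall i, A (a i), forall i, B (x i) & v = \sum_i a i *: x i]].

Definition pow_ideal (A : set R) (n : nat) : set R :=
  iter n (@mul_set R^o A) setT.

Definition maximal_left_ideal (m : submodClosed R^o) : Prop :=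
  1 \notin m /\
  forall n : submodClosed R^o, {subset m <= n} -> 1 \notin n -> n =i m.

Definition jacobson : set R :=
  [set x | forall m : submodClosed R^o, maximal_left_ideal m -> x \in m].

Definition loewy_length (M : lmodType R) : enat :=
  least (fun t => mul_set (pow_ideal jacobson t) [set: M] = [set 0]).

Definition maximal_loewy_length (M : lmodType R) : Prop :=
  loewy_length M = loewy_length R^o.

Lemma jacobson0 : jacobson 0.
Proof. by move=> m _; exact: rpred0. Qed.

Lemma jacobsonD x y : jacobson x -> jacobson y -> jacobson (x + y).
Proof. by move=> Jx Jy m mm; rewrite rpredD ?Jx ?Jy. Qed.

Lemma jacobsonM a x : jacobson x -> jacobson (a * x).
Proof. by move=> Jx m mm; apply: (@rpredZ R R^o m a x); exact: Jx. Qed.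

Section Radical.
Variable M : lmodType R.

Definition rad_pred : {pred M} :=
  fun x => `[< mul_set jacobson [set: M] x >].

Fact rad_submod_closed : submod_closed rad_pred.
Proof.
split.
  by apply/asboolP; exists 0%N, (fun=> 0), (fun=> 0); split=> //;
    rewrite ?big_ord0 // => i; exact: jacobson0.
move=> a u v /asboolP[n [b [x [Jb _ ->]]]] /asboolP[m [c [y [Jc _ ->]]]].
apply/asboolP.
exists (n + m)%N,
  (fun i => match fintype.split i with inl j => a * b j | inr j => c j end),
  (fun i => match fintype.split i with inl j => x j | inr j => y j end).
split=> //; first by move=> i; case: fintype.split => j //; exact: jacobsonM.
rewrite big_split_ord /= scaler_sumr; congr (_ + _); apply: eq_bigr => i _.
  by rewrite (unsplitK (inl i : 'I_n + 'I_m)) scalerA.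
by rewrite (unsplitK (inr i : 'I_n + 'I_m)).
Qed.
HB.instance Definition _ := GRing.isSubmodClosed.Build R M rad_pred
  rad_submod_closed.

Definition top_mod : lmodType R := quot_mod rad_pred.
End Radical.

(* [R f], as a submodule of [R^o]. *)
Definition left_mul_pred (f : R) : {pred R^o} :=
  fun x => `[< exists a : R, x = a * f >].

Fact left_mul_submod_closed f : submod_closed (left_mul_pred f).
Proof.
split; first by apply/asboolP; exists 0; rewrite mul0r.
move=> a u v /asboolP[b ->] /asboolP[c ->]; apply/asboolP.
by exists (a * b + c); rewrite mulrDl -mulrA.
Qed.
HB.instance Definition _ f := GRing.isSubmodClosed.Build R R^o (left_mul_pred f)
  (left_mul_submod_closed f).

Definition left_mul_mod (f : R) : lmodType R := submod (left_mul_pred f).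

(* [J(R) f], as a submodule of [R f]. *)
Definition jac_mul_pred (f : R) : {pred left_mul_mod f} :=
  fun x => `[< exists2 a : R, jacobson a & val x = a * f >].

Fact jac_mul_submod_closed f : submod_closed (@jac_mul_pred f).
Proof.
split; first by apply/asboolP; exists 0; rewrite ?mul0r //; exact: jacobson0.
move=> a u v /asboolP[b Jb eb] /asboolP[c Jc ec]; apply/asboolP.
exists (a * b + c); first by apply: jacobsonD => //; exact: jacobsonM.
have -> : val (a *: u + v) = a * val u + val v by [].
by rewrite eb ec mulrDl -mulrA.
Qed.
HB.instance Definition _ f := GRing.isSubmodClosed.Build R (left_mul_mod f)
  (@jac_mul_pred f) (@jac_mul_submod_closed f).

Definition left_mul_top (f : R) : lmodType R := quot_mod (@jac_mul_pred f).

Definition quasi_uniform_loewy_length : Prop :=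
  forall P : lmodType R, projective P -> indecomposable P ->
    injdim (top_mod P) = None -> maximal_loewy_length P.
End Loewy.

Record quiver := Quiver {
  vertex : finType;
  arrow : finType;
  source : arrow -> vertex;
  target : arrow -> vertex
}.

Section PathAlgebra.
Variables (k : fieldType) (Q : quiver).

Fixpoint is_qpath (i : vertex Q) (s : seq (arrow Q)) : bool :=
  if s is a :: s' then (source a == i) && is_qpath (target a) s' else true.

Definition qend (i : vertex Q) (s : seq (arrow Q)) : vertex Q :=
  last i (map (@target Q) s).

(* A path is its starting vertex with its arrows, in the order of travel. *)
Definition qpath := {p : vertex Q * seq (arrow Q) | is_qpath p.1 p.2}.

Definition qlen (p : qpath) : nat := size (val p).2.

Definition qtriv (i : vertex Q) : qpath :=
  exist (fun p => is_qpath p.1 p.2) (i, [::]) isT.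

Fact is_qpath_arrow (a : arrow Q) : is_qpath (source a) [:: a].
Proof. by rewrite /= eqxx. Qed.

Definition qarrow (a : arrow Q) : qpath :=
  exist (fun p => is_qpath p.1 p.2) (source a, [:: a]) (is_qpath_arrow a).

Lemma is_qpath_cat i s t :
  is_qpath i (s ++ t) = is_qpath i s && is_qpath (qend i s) t.
Proof. by elim: s i => //= a s IH i; rewrite IH andbA. Qed.

Fact is_qpath_take (p : qpath) j : is_qpath (val p).1 (take j (val p).2).
Proof.
by have := valP p; rewrite -{1}(cat_take_drop j (val p).2) is_qpath_cat
  => /andP[].
Qed.

Fact is_qpath_drop (p : qpath) j :
  is_qpath (qend (val p).1 (take j (val p).2)) (drop j (val p).2).
Proof.
by have := valP p; rewrite -{1}(cat_take_drop j (val p).2) is_qpath_cat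
  => /andP[].
Qed.

(* [qtake j p] is the path of the first [j] arrows of [p], and [qdrop j p] is
   the rest, so that [p] is [qtake j p] followed by [qdrop j p]. *)
Definition qtake (j : nat) (p : qpath) : qpath :=
  exist (fun p => is_qpath p.1 p.2) (_, _) (is_qpath_take p j).

Definition qdrop (j : nat) (p : qpath) : qpath :=
  exist (fun p => is_qpath p.1 p.2) (_, _) (is_qpath_drop p j).

(* The elements of the path algebra are the finitely supported functions from
   paths to [k]. *)
Definition finsupp_pred : {pred (qpath -> k^o)} :=
  fun f => `[< exists s : seq qpath, forall p, f p != 0 -> p \in s >].

Fact finsupp_submod_closed : submod_closed finsupp_pred.
Proof.
split; first by apply/asboolP; exists [::] => p; rewrite eqxx.
move=> a f g /asboolP[s hs] /asboolP[t ht]; apply/asboolP.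
exists (s ++ t) => p; apply: contraR; rewrite mem_cat negb_or => /andP[ps pt].
have /eqP f0 : f p == 0 by apply: contraR ps; exact: hs.
have /eqP g0 : g p == 0 by apply: contraR pt; exact: ht.
by rewrite /= !fctE f0 g0 scaler0 addr0.
Qed.
HB.instance Definition _ := GRing.isSubmodClosed.Build k (qpath -> k^o)
  finsupp_pred finsupp_submod_closed.

Definition path_alg := {f : qpath -> k^o | f \in finsupp_pred}.
HB.instance Definition _ := SubChoice.on path_alg.
HB.instance Definition _ := [SubChoice_isSubLmodule of path_alg by <:].

Definition coef (f : path_alg) (p : qpath) : k := val f p.

(* The product extends concatenation of paths bilinearly: the coefficient of
   [f * g] at [p] collects all ways of writing [p] as a path followed by a
   path. *)
Definition conv (f g : path_alg) : qpath -> k :=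
  fun p => \sum_(j < (qlen p).+1) coef f (qtake j p) * coef g (qdrop j p).

Fact conv_finsupp f g : conv f g \in finsupp_pred.
Proof.
have /asboolP[s hs] := valP f; have /asboolP[t ht] := valP g.
apply/asboolP.
exists (pmap insub [seq ((val x).1, (val x).2 ++ (val y).2) | x <- s, y <- t]).
move=> p; apply: contraR => np; apply/eqP/big1 => j _.
apply/eqP; rewrite mulf_eq0; apply: contraR np; rewrite negb_or.
case/andP=> /hs ps /ht pt; rewrite mem_pmap_sub.
apply/allpairsP; exists (qtake j p, qdrop j p); split=> //=.
by rewrite cat_take_drop -surjective_pairing.
Qed.

Definition path_mul (f g : path_alg) : path_alg :=
  exist (fun f => f \in finsupp_pred) _ (conv_finsupp f g).

Lemma coefM f g p : coef (path_mul f g) p =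
  \sum_(j < (qlen p).+1) coef f (qtake j p) * coef g (qdrop j p).
Proof. by []. Qed.

Lemma coefD f g p : coef (f + g) p = coef f p + coef g p.
Proof. by []. Qed.

Lemma path_algP f g : (forall p, coef f p = coef g p) -> f = g.
Proof. by move=> h; apply/val_inj/funext. Qed.

Fact one_finsupp :
  (fun p : qpath => (qlen p == 0%N)%:R : k^o) \in finsupp_pred.
Proof.
apply/asboolP; exists [seq qtriv i | i <- enum (vertex Q)] => p.
case: (qlen p =P 0%N) => [p0 _|_]; last by rewrite eqxx.
have {}p0 : (val p).2 = [::] by exact: size0nil.
apply/mapP; exists (val p).1; first by rewrite mem_enum.
by apply/val_inj; rewrite /= [LHS]surjective_pairing p0.
Qed.

Definition path_one : path_alg :=
  exist (fun f => f \in finsupp_pred) _ one_finsupp.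

Fact path_elt_finsupp (p : qpath) :
  (fun q : qpath => (q == p)%:R : k^o) \in finsupp_pred.
Proof.
apply/asboolP; exists [:: p] => q; rewrite inE.
by case: (q =P p) => // _; rewrite eqxx.
Qed.

(* The element of the path algebra given by a single path. *)
Definition path_elt (p : qpath) : path_alg :=
  exist (fun f => f \in finsupp_pred) _ (path_elt_finsupp p).

Lemma qpathP (p q : qpath) :
  (val p).1 = (val q).1 -> (val p).2 = (val q).2 -> p = q.
Proof.
move=> h1 h2; apply/val_inj.
by rewrite [LHS]surjective_pairing h1 h2 -surjective_pairing.
Qed.

Lemma qtake_len (p : qpath) : qtake (qlen p) p = p.
Proof. by apply: qpathP => //=; rewrite take_size. Qed.

Lemma qdrop0 (p : qpath) : qdrop 0 p = p.
Proof. by apply: qpathP => /=; rewrite ?take0 ?drop0. Qed.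

Lemma qlen_take j (p : qpath) : (j <= qlen p)%N -> qlen (qtake j p) = j.
Proof. by move=> h; rewrite /qlen /= size_takel. Qed.

Lemma qlen_drop j (p : qpath) : qlen (qdrop j p) = (qlen p - j)%N.
Proof. by rewrite /qlen /= size_drop. Qed.

Lemma qtake_take i j (p : qpath) : (i <= j)%N -> qtake i (qtake j p) = qtake i p.
Proof. by move=> h; apply: qpathP => //=; rewrite take_takel. Qed.

Lemma qdrop_drop i j (p : qpath) : qdrop i (qdrop j p) = qdrop (i + j) p.
Proof.
apply: qpathP => /=; last by rewrite drop_drop.
by rewrite addnC takeD /qend map_cat last_cat.
Qed.

Lemma qtake_drop i j (p : qpath) :
  qtake i (qdrop j p) = qdrop j (qtake (i + j) p).
Proof.
apply: qpathP => /=; last by rewrite take_drop.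
by rewrite take_takel // leq_addl.
Qed.

Lemma sum_triangle (n : nat) (F : nat -> nat -> k) :
  \sum_(j < n.+1) \sum_(l < j.+1) F l (j - l)%N =
  \sum_(l < n.+1) \sum_(m < (n - l).+1) F l m.
Proof.
elim: n => [|n IH]; first by rewrite !big_ord1.
rewrite big_ord_recr /= IH [RHS]big_ord_recr /= subnn big_ord1.
rewrite [X in _ + X]big_ord_recr /= subnn addrA; congr (_ + _).
rewrite -big_split /=; apply: eq_bigr => l _.
by rewrite subSn ?[RHS]big_ord_recr // -ltnS.
Qed.

Fact path_mulA : associative path_mul.
Proof.
move=> f g h; apply: path_algP => p; rewrite !coefM; symmetry.
transitivity (\sum_(j < (qlen p).+1) \sum_(l < j.+1)
    coef f (qtake l p) * (coef g (qtake (j - l) (qdrop l p)) *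
      coef h (qdrop (j - l) (qdrop l p)))).
  apply: eq_bigr => j _; have jp : (j <= qlen p)%N by rewrite -ltnS.
  rewrite coefM mulr_suml qlen_take //; apply: eq_bigr => l _.
  have lj : (l <= j)%N by rewrite -ltnS.
  by rewrite qtake_take // qtake_drop qdrop_drop subnK // mulrA.
rewrite (sum_triangle _ (fun l m => coef f (qtake l p) *
  (coef g (qtake m (qdrop l p)) * coef h (qdrop m (qdrop l p))))).
by apply: eq_bigr => l _; rewrite coefM qlen_drop mulr_sumr.
Qed.

Lemma coef1 p : coef path_one p = (qlen p == 0%N)%:R.
Proof. by []. Qed.

Fact path_mul1 : left_id path_one path_mul.
Proof.
move=> f; apply: path_algP => p; rewrite coefM big_ord_recl /= big1 => [|j _].
  by rewrite coef1 qlen_take // mul1r qdrop0 addr0.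
by rewrite coef1 qlen_take ?mul0r.
Qed.

Fact path_1mul : right_id path_one path_mul.
Proof.
move=> f; apply: path_algP => p; rewrite coefM big_ord_recr /= big1 => [|j _].
  by rewrite coef1 qlen_drop subnn eqxx mulr1 qtake_len add0r.
by rewrite coef1 qlen_drop subn_eq0 leqNgt ltn_ord mulr0.
Qed.

Fact path_mulDl : left_distributive path_mul +%R.
Proof.
move=> f g h; apply: path_algP => p; rewrite coefD !coefM -big_split /=.
by apply: eq_bigr => j _; rewrite coefD mulrDl.
Qed.

Fact path_mulDr : right_distributive path_mul +%R.
Proof.
move=> f g h; apply: path_algP => p; rewrite coefD !coefM -big_split /=.
by apply: eq_bigr => j _; rewrite coefD mulrDr.
Qed.

HB.instance Definition _ := GRing.Zmodule_isPzRing.Build path_alg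
  path_mulA path_mul1 path_1mul path_mulDl path_mulDr.

Definition arrow_ideal : set path_alg :=
  [set x | forall S : ideal path_alg,
     (forall a, path_elt (qarrow a) \in S) -> x \in S].

Definition admissible (I : ideal path_alg) : Prop :=
  exists2 m, (2 <= m)%N &
    pow_ideal arrow_ideal m `<=` [set x | x \in I] /\
    [set x | x \in I] `<=` pow_ideal arrow_ideal 2.

Section BoundQuiverAlgebra.
Variable I : ideal path_alg.

(* Only the ring structure of the quotient enters into the statement. *)
Definition bound_quiver_alg : pzRingType := quot_ring I.

Definition vertex_idem (i : vertex Q) : bound_quiver_alg :=
  quot_proj I (path_elt (qtriv i)).

Definition f_nm : bound_quiver_alg :=
  \sum_(i | `[< ~ maximal_loewy_length (left_mul_mod (vertex_idem i)) >])
    vertex_idem i.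
End BoundQuiverAlgebra.
End PathAlgebra.

(* Main.v *)
Require Import Defs.
From HB Require Import structures.
From mathcomp Require Import all_boot all_algebra generic_quotient ring_quotient.
From mathcomp Require Import boolp classical_sets functions.

(** Write J for the radical, l for the Loewy length of the algebra, and S_j for
    the simple top of the projective at the vertex j.

    Let M have projective dimension n+1, and let 0 -> P1 -> P0 -> K -> 0 be the
    last step of a projective resolution of M, so that K is an n-th syzygy.  If
    P1/J P1 -> P0/J P0 were injective, a retraction of it (the algebra is
    semisimple modulo J) would lift to a map P0 -> P1 which is a retraction
    modulo J, and, J being nilpotent, it could be corrected to a genuine one:
    K would be projective.  So there is some x = e_j x in P1, outside J P1, whose
    image lies in J P0.  If the projective at j had Loewy length l, then
    a e_j <> 0 for some a in J^(l-1); a map from P1 to the algebra which sends x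
    to e_j modulo J shows that a x <> 0, although a maps J P0 into J^l P0 = 0.
    Hence the projective at j has non-maximal Loewy length.  On the other hand
    there is a map P1 -> S_j which does not vanish at x, and it does not extend
    to P0, because maps to S_j vanish on J P0.  So Ext^1(K,S_j) = Ext^(n+1)(M,S_j)
    is not zero and S_j has injective dimension greater than n.  The resolution
    need not be minimal, and S_j may be replaced by any module that is killed by
    J and contains S_j: this is [big_findim_le].  The module in the theorem
    contains all S_j with j non-maximal, which gives the first bound.

    Quasi-uniform Loewy length gives these S_j finite injective
    dimensions, so that their maximum bounds the finitistic dimension.
    To compare with the opposite algebra, let D be duality over the ground field.
    It exchanges injective and projective modules ([dual_injective],
    [dual_projective]), so that D S_j is a finitely generated module of finite
    projective dimension over the opposite algebra.  This dimension is at most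
    the small finitistic dimension d, and dualizing once more, D D S_j has
    injective dimension at most d.  As D D S_j contains S_j and is killed by J,
    [big_findim_le] applies to it. *)

Set Implicit Arguments.
Unset Strict Implicit.
Unset Printing Implicit Defensive.

Import GRing.Theory.
Local Open Scope ring_scope.
Local Open Scope classical_set_scope.

(** * Linear maps and vector spaces *)

Lemma linear_of (R : pzRingType) (A B : lmodType R) (f : A -> B) :
  (forall a x y, f (a *: x + y) = a *: f x + f y) ->
  exists h : {linear A -> B}, h =1 f.
Proof.
move=> lf.
pose hM := GRing.isLinear.Build R A B _ f lf.
pose h : {linear A -> B} := HB.pack f hM.
by exists h.
Qed.

Definition onto (A B : Type) (f : A -> B) := forall y, exists x, f x = y.

Lemma factor_surj (R : pzRingType) (P M N : lmodType R) (p : {linear P -> M})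
    (g : {linear P -> N}) :
  onto p -> (forall y, p y = 0 -> g y = 0) ->
  exists h : {linear M -> N}, forall y, h (p y) = g y.
Proof.
move=> sp pg; have [s sE] := choice sp.
have gs y : g (s (p y)) = g y.
  by apply/subr0_eq; rewrite -raddfB; apply: pg; rewrite raddfB /= sE subrr.
have [|h hE] := @linear_of _ _ _ (g \o s).
  by move=> a x y /=; rewrite -[RHS]linearP -[in RHS]gs linearP !sE.
by exists h => y; rewrite hE /= gs.
Qed.

Lemma factor_inj (R : pzRingType) (K P N : lmodType R) (i : {linear K -> P})
    (g : {linear N -> P}) :
  injective i -> (forall x, exists y, i y = g x) ->
  exists h : {linear N -> K}, forall x, i (h x) = g x.
Proof.
move=> ii ig; have [s sE] := choice ig.
have [|h hE] := @linear_of _ _ _ s.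
  by move=> a x y; apply: ii; rewrite linearP !sE linearP.
by exists h => x; rewrite hE sE.
Qed.

Lemma linear_inj (R : pzRingType) (A B : lmodType R) (f : {linear A -> B}) :
  (forall x, f x = 0 -> x = 0) -> injective f.
Proof.
by move=> h x y e; apply/subr0_eq/h; rewrite raddfB /= e subrr.
Qed.

Section VectorSpaces.
Variable k : fieldType.

(** Zorn's lemma on partial extensions, ordered by inclusion of their graphs.  A
    candidate is a set of pairs whose union with the graph to be extended is
    linear and single-valued: with this union, the empty chain needs no special
    treatment. *)
Lemma vspace_injective (E : lmodType k) : injective_mod E.
Proof.
move=> A B g f gi.
pose base : set (B * E) := [set u | exists a, u = (g a, f a)].
pose good (G : set (B * E)) :=
  (forall c u v, G u -> G v -> G (c *: u + v)) /\
  (forall b w w', G (b, w) -> G (b, w') -> w = w').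
have baseL c u v : base u -> base v -> base (c *: u + v).
  by move=> [a ->] [a' ->]; exists (c *: a + a'); rewrite !linearP.
have [|G [[GL GF] Gmax]] := @Zorn_bigcup (B * E) (fun G => good (G `|` base)).
  move=> F FP Ftot.
  have common u v : (\bigcup_(X in F) X `|` base) u ->
      (\bigcup_(X in F) X `|` base) v -> (base u /\ base v) \/
      exists2 X, F X & (X `|` base) u /\ (X `|` base) v.
    move=> [[X FX Xu]|bu] [[Y FY Yv]|bv]; last by left.
    - right; have [XY|YX] := Ftot X Y FX FY.
        by exists Y => //; split; left=> //; apply: XY.
      by exists X => //; split; left=> //; apply: YX.
    - by right; exists X => //; split; [left|right].
    - by right; exists Y => //; split; [right|left].
  split=> [c u v hu hv|b w w' hu hv].
    have [[bu bv]|[X FX [Xu Xv]]] := common _ _ hu hv.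
      by right; exact: baseL.
    have [XL _] := FP _ FX; have [Xw|bw] := XL c _ _ Xu Xv; last by right.
    by left; exists X.
  have [[[a [-> ->]] [a' [/gi -> ->]]]//|[X FX [Xu Xv]]] := common _ _ hu hv.
  by have [_ XF] := FP _ FX; exact: XF Xu Xv.
set G' := G `|` base in GL GF.
have G0 : G' 0 by right; exists 0; rewrite !linear0.
have total b : exists w, G' (b, w).
  apply: contrapT => nb.
  have nD c u w : G' (u, w) -> u = c *: b -> c = 0.
    move=> Gu ub; apply/eqP; apply: contra_notT nb => c0; exists (c^-1 *: w).
    suff -> : (b, c^-1 *: w) = c^-1 *: (u, w) + 0 by exact: GL.
    by rewrite addr0 ub [RHS]surjective_pairing /= scalerA mulVf // scale1r.
  (* Extend by the value 0 at b. *)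
  pose H : set (B * E) := [set v | exists2 u, G' u & exists c, v = (u.1 + c *: b, u.2)].
  have GH : G' `<=` H.
    by move=> u Gu; exists u => //; exists 0; rewrite scale0r addr0 -surjective_pairing.
  have bH : H (b, 0) by exists 0 => //; exists 1; rewrite scale1r add0r.
  apply: (Gmax H).
    split; first by move=> u Gu; apply: GH; left.
    by move=> HG; apply: nb; exists 0; left; apply: HG.
  have -> : H `|` base = H.
    by apply/seteqP; split=> u; [case=> // bu; apply: GH; right | left].
  split=> [c u v [u' Gu [d ->]] [v' Gv [d' ->]]|v w w'].
    exists (c *: u' + v'); first exact: GL.
    exists (c * d + d'); congr (_, _) => /=.
    by rewrite scalerDr scalerDl -scalerA addrACA.
  move=> [[u1 u2] Gu [c [-> ->]]] [[v1 v2] Gv [c' [/= e ->]]].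
  have cc : c = c'.
    apply/subr0_eq; apply: (nD _ (v1 - u1) (v2 - u2)).
      by have := GL (-1) _ _ Gu Gv; rewrite scaleN1r addrC.
    have -> : v1 = u1 + c *: b - c' *: b by rewrite e addrK.
    by rewrite scalerBl addrC !addrA addNr add0r.
  move: e Gu; rewrite cc => /addIr ->  Gu; exact: GF Gu Gv.
have [s sE] := choice total.
have [|h hE] := @linear_of _ _ _ s.
  move=> c u v; exact: (GF _ _ _ (sE _) (GL c _ _ (sE u) (sE v))).
exists h => x; rewrite hE; apply: (GF _ _ _ (sE _)); right; by exists x.
Qed.

Lemma functional_neq0 (V : lmodType k) (x : V) :
  x <> 0 -> exists f : {linear V -> k^o}, f x = 1.
Proof.
move=> x0.
have [|g gE] := @linear_of _ (k^o : lmodType k) V (fun a => (a : k) *: x).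
  by move=> a b c; rewrite scalerDl scalerA.
have [|h hE] := @vspace_injective k^o _ _ g idfun.
  apply: linear_inj => a; rewrite gE => /eqP; rewrite scaler_eq0 => /orP[/eqP//|/eqP].
  by [].
by exists h; have := hE 1; rewrite gE scale1r.
Qed.
End VectorSpaces.

Section Kernel.
Variables (R : pzRingType) (A B : lmodType R) (f : {linear A -> B}).

Definition ker_pred : {pred A} := fun x => f x == 0.

Fact ker_submod_closed : submod_closed ker_pred.
Proof.
split; first by apply/eqP; rewrite linear0.
by move=> a u v /eqP fu /eqP fv; apply/eqP; rewrite linearP fu fv scaler0 addr0.
Qed.
HB.instance Definition _ := GRing.isSubmodClosed.Build R A ker_pred
  ker_submod_closed.

Definition ker_mod : lmodType R := submod ker_pred.

Lemma ker_incl : exists i : {linear ker_mod -> A}, injective i /\ exact_at i f.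
Proof.
exists (\val : {linear ker_mod -> A}); split; first exact: val_inj.
move=> y; split=> [/eqP fy|[x <-]]; last by apply/eqP; exact: (valP x).
by exists (exist _ y fy).
Qed.
End Kernel.

(** Surjections split: subtract from the identity a retraction onto the kernel. *)
Lemma vspace_projective (k : fieldType) (P : lmodType k) : projective P.
Proof.
move=> A B g f gs; have [i [ii iE]] := ker_incl g.
have [r rE] := vspace_injective (E := ker_mod g) idfun ii.
have [||s sE] := @factor_surj _ _ _ A g (idfun \- (i \o r)) => //.
  by move=> y /iE[x <-] /=; rewrite rE subrr.
exists (s \o f : {linear P -> A}) => x /=; have [a <-] := gs (f x).
by rewrite sE /= raddfB /= [X in _ - X](_ : _ = 0) ?subr0 //; apply/iE; eexists.
Qed.

(** * Short exact sequences, dimensions and vanishing of Ext *)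

Lemma projective_retract (R : pzRingType) (P M : lmodType R)
    (s : {linear M -> P}) (p : {linear P -> M}) :
  (forall x, p (s x) = x) -> projective P -> projective M.
Proof.
move=> ps Pp A B g f gs.
have [h hE] := Pp A B g (f \o p : {linear P -> B}) gs.
by exists (h \o s : {linear M -> A}) => x; rewrite /= hE /= ps.
Qed.

Lemma projective_bij (R : pzRingType) (P M : lmodType R) (p : {linear P -> M}) :
  injective p -> onto p -> projective P -> projective M.
Proof.
move=> ip sp; have [s sE] := @factor_inj _ P M M p idfun ip sp.
exact: (@projective_retract _ _ _ s p).
Qed.

Lemma injective_retract (R : pzRingType) (E M : lmodType R)
    (s : {linear M -> E}) (p : {linear E -> M}) :
  (forall x, p (s x) = x) -> injective_mod E -> injective_mod M.
Proof.
move=> ps Ei A B g f gi.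
have [h hE] := Ei A B g (s \o f : {linear A -> E}) gi.
by exists (p \o h : {linear B -> M}) => x; rewrite /= hE /= ps.
Qed.

Section Homological.
Variable R : pzRingType.
Implicit Types A B C M N K P E S : lmodType R.

Definition short_exact A B C (i : {linear A -> B}) (p : {linear B -> C}) :=
  [/\ injective i, exact_at i p & onto p].

(** Resolutions are unrolled into short exact sequences, on which inductions over
    the dimension are direct. *)
Fixpoint pd_le (n : nat) (M : lmodType R) : Prop :=
  if n is n'.+1 then
    exists (K P : lmodType R) (i : {linear K -> P}) (p : {linear P -> M}),
      [/\ short_exact i p, projective P & pd_le n' K]
  else projective M.

Fixpoint id_le (n : nat) (M : lmodType R) : Prop :=
  if n is n'.+1 then
    exists (E C : lmodType R) (i : {linear M -> E}) (p : {linear E -> C}),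
      [/\ short_exact i p, injective_mod E & id_le n' C]
  else injective_mod M.

Lemma zero_projective M : zero_mod M -> projective M.
Proof.
move=> M0 A B g f _; exists (\0 : {linear M -> A}) => x.
by rewrite (M0 x) !linear0.
Qed.

Definition zero_lmod : lmodType R := 'rV[R]_0.

Lemma zero_lmod_zero : zero_mod zero_lmod.
Proof. by move=> x; apply/matrixP => i []. Qed.

Lemma proj_resolutionP M n : has_proj_resolution M n <-> pd_le n M.
Proof.
split; elim: n M => [|n IH] M.
- move=> [P [d [eps [Pp P0 es ex0 ex]]]].
  apply: (@projective_bij _ _ _ eps) (Pp 0%N) => //.
  by apply: linear_inj => x /ex0[y <-]; rewrite (P0 1%N isT y) linear0.
- move=> [P [d [eps [Pp P0 es ex0 ex]]]].
  have [i [ii iE]] := ker_incl eps.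
  exists (ker_mod eps), (P 0%N), i, eps; split=> //.
  have [|e eE] := @factor_inj _ _ _ _ i (d 0%N) ii.
    by move=> x; apply/iE/ex0; exists x.
  apply: IH; exists (fun j => P j.+1), (fun j => d j.+1), e.
  split=> // [j jn|x|y].
  + by apply: P0; rewrite ltnS.
  + have /ex0[y yE] : eps (i x) = 0 by apply/iE; exists x.
    by exists y; apply: ii; rewrite eE.
  + split=> [ey|/ex]; first by apply/ex; rewrite -eE ey linear0.
    by move=> dy; apply: ii; rewrite eE dy linear0.
- move=> Mp; pose P j : lmodType R := if j is 0%N then M else zero_lmod.
  exists P, (fun j => \0), idfun; split=> //.
  + by case=> [|j] //=; apply: zero_projective; exact: zero_lmod_zero.
  + by case=> [|j] //= _; exact: zero_lmod_zero.
  + by move=> x; exists x.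
  + by move=> y; split=> [/= ->|[x <-]] //; exists 0.
  + move=> j y; split=> [_|[x <-]]; last by [].
    by exists 0; rewrite (zero_lmod_zero y).
- move=> [K [P' [i [p [[ii ex' ps] P'p /IH]]]]].
  move=> [P [d [eps [Pp P0 es ex0 ex]]]].
  pose Q j : lmodType R := if j is j'.+1 then P j' else P'.
  pose dQ j : {linear Q j.+1 -> Q j} :=
    match j return {linear Q j.+1 -> Q j} with
    | 0 => i \o eps : {linear P 0%N -> P'}
    | j'.+1 => d j'
    end.
  exists Q, dQ, p; split=> //.
  + by case.
  + by case=> [|j] //=; rewrite ltnS; exact: P0.
  + move=> y; split=> [/ex'[x <-]|[x <-]].
      by have [z <-] := es x; exists z.
    by apply/ex'; exists (eps x).
  + case=> [|j] //= y.
    split=> [/= h|/ex0 /= ->]; last by rewrite linear0.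
    by apply/ex0/ii; rewrite linear0.
Qed.

Lemma inj_resolution_id_le M n : has_inj_resolution M n -> id_le n M.
Proof.
elim: n M => [|n IH] M [E [d [eta [Ei E0 ie ex0 ex]]]].
  have [|s sE] := @factor_inj _ M (E 0%N) (E 0%N) eta idfun ie.
    by move=> x; apply/ex0; exact: E0.
  apply: (@injective_retract _ _ _ eta s) (Ei 0%N) => x.
  by apply: ie; rewrite sE.
(* The cosyzygy is the image of the first differential, which is the kernel of
   the second one. *)
have [i [ii iE]] := ker_incl (d 1%N).
have [|p pE] := @factor_inj _ _ _ _ i (d 0%N) ii.
  by move=> x; apply/iE/ex; exists x.
exists (E 0%N), (ker_mod (d 1%N)), eta, p; split=> //.
  split=> // [y|z].
    split=> [py|/ex0 dy]; first by apply/ex0; rewrite -pE py linear0.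
    by apply: ii; rewrite pE dy linear0.
  have /ex[y yE] : d 1%N (i z) = 0 by apply/iE; exists z.
  by exists y; apply: ii; rewrite pE.
apply: IH; exists (fun j => E j.+1), (fun j => d j.+1), i.
by split=> // j jn; apply: E0; rewrite ltnS.
Qed.

(** Ext^1(M,S) = 0, in terms of extending maps along all short exact sequences that
    end in M. *)
Definition ext1_zero M S : Prop :=
  forall A B (i : {linear A -> B}) (p : {linear B -> M}), short_exact i p ->
  forall f : {linear A -> S}, exists h : {linear B -> S}, forall x, h (i x) = f x.

(** Ext^(n+1)(M,S) = 0, expressed through Ext^1 of every n-th syzygy of M. *)
Fixpoint ext_zero (n : nat) (M S : lmodType R) : Prop :=
  if n is n'.+1 then
    forall (K P : lmodType R) (i : {linear K -> P}) (p : {linear P -> M}),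
      short_exact i p -> projective P -> ext_zero n' K S
  else ext1_zero M S.

(** Dimension shifting: both groups are Ext^2(N,S), for N the cokernel of [i] (here
    [M]).  To extend [f : A -> S] along [a], extend [j \o f] to [g : B -> E]; the map
    that [g] induces from [K] to [C] extends to [P], hence lifts to [P -> E], and
    subtracting the lift from [g] brings its values back into [S]. *)
Lemma ext1_zero_shift K P M S E C (i : {linear K -> P}) (p : {linear P -> M})
    (j : {linear S -> E}) (q : {linear E -> C}) :
  short_exact i p -> projective P -> short_exact j q -> injective_mod E ->
  ext1_zero M C -> ext1_zero K S.
Proof.
move=> ip Pp [ij exE sq] Ei ext A B a b [ia exB sb] f.
have [g gE] := Ei A B a (j \o f : {linear A -> E}) ia.
have [|g' g'E] := @factor_surj _ B K C b (q \o g : {linear B -> C}) sb.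
  by move=> y /exB[x <-] /=; rewrite gE /=; apply/exE; exists (f x).
have [u uE] := ext _ _ _ _ ip g'.
have [v vE] := Pp _ _ q u sq.
have [|h hE] := @factor_inj _ S E B j (g \- (v \o i \o b)) ij.
  by move=> y; apply/exE; rewrite /= raddfB /= vE uE g'E subrr.
exists h => x; apply: ij; rewrite hE /= gE /=.
suff -> : b (a x) = 0 by rewrite !linear0 addr0.
by apply/exB; exists x.
Qed.

Lemma ext_zero_shift n M S E C (j : {linear S -> E}) (q : {linear E -> C}) :
  short_exact j q -> injective_mod E -> ext_zero n M C -> ext_zero n.+1 M S.
Proof.
move=> jq Ei; elim: n M => [|n IH] M ext K P i p ip Pp.
  exact: ext1_zero_shift ip Pp jq Ei ext.
by apply: IH; exact: ext ip Pp.
Qed.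

Lemma id_le_ext_zero d n M S : id_le d S -> (d <= n)%N -> ext_zero n M S.
Proof.
elim: d n S M => [|d IH] n S M.
  move=> Si _; elim: n M => [|n IHn] M; last by move=> K P i p _ _; exact: IHn.
  by move=> A B i p [ii _ _] f; exact: Si.
move=> [E [C [j [q [jq Ei idC]]]]]; case: n => // n dn.
by apply: (ext_zero_shift jq Ei); exact: IH.
Qed.
End Homological.

(** * Restriction of scalars, quotients and powers of ideals *)

Section RestrictScalars.
Variables (k R : pzRingType).

Definition rscal (c : {rmorphism k -> R}) (M : lmodType R) : Type := M.

Variables (c : {rmorphism k -> R}) (M : lmodType R).
HB.instance Definition _ := GRing.Zmodule.on (rscal c M).

Definition rscal_scale (a : k) (x : (rscal c M)) : (rscal c M) := c a *: (x : M).

Fact rscal_scaleA a b x : rscal_scale a (rscal_scale b x) = rscal_scale (a * b) x.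
Proof. by rewrite /rscal_scale scalerA rmorphM. Qed.

Fact rscal_scale1 : left_id 1 rscal_scale.
Proof. by move=> x; rewrite /rscal_scale rmorph1 scale1r. Qed.

Fact rscal_scaleDr : right_distributive rscal_scale +%R.
Proof. by move=> a x y; rewrite /rscal_scale scalerDr. Qed.

Fact rscal_scaleDl x : {morph rscal_scale^~ x : a b / a + b}.
Proof. by move=> a b; rewrite /rscal_scale rmorphD scalerDl. Qed.

HB.instance Definition _ := GRing.Zmodule_isLmodule.Build k (rscal c M)
    rscal_scaleA rscal_scale1 rscal_scaleDr rscal_scaleDl.

Lemma rscalE (a : k) (x : (rscal c M)) : a *: x = c a *: (x : M) :> M.
Proof. by []. Qed.
End RestrictScalars.

Lemma rscal_linear (k R : pzRingType) (c : {rmorphism k -> R}) (M N : lmodType R)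
    (f : {linear M -> N}) :
  exists g : {linear rscal c M -> rscal c N}, forall x, g x = f x.
Proof.
have [|g gE] := @linear_of _ (rscal c M) (rscal c N) f; last by exists g.
by move=> a x y; exact: linearP.
Qed.

Lemma quot_mod_linear (R : pzRingType) (M : lmodType R) (U : submodClosed M) :
  exists p : {linear M -> quot_mod U}, onto p /\ forall x, p x = 0 <-> x \in U.
Proof.
have [|p pE] := @linear_of _ M (quot_mod U) (quot_mod_proj U).
  by move=> a x y; rewrite quot_mod_projD -quot_mod_projZ.
exists p; split=> [y|x].
  by exists (repr y); rewrite pE quot_mod_projK.
have p0 : quot_mod_proj U 0 = 0 by rewrite -pE linear0.
by rewrite pE -p0; split=> [/eqP|xU]; [|apply/eqP]; rewrite quot_mod_proj_eq subr0.
Qed.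

Section Least.
Variable P : nat -> Prop.

Lemma least_Some n : least P = Some n -> P n /\ forall m, P m -> (n <= m)%N.
Proof.
rewrite /least; case: pselect => // h [<-]; case: ex_minnP => m /asboolP Pm min.
by split=> // j Pj; apply: min; exact/asboolP.
Qed.

Lemma le_enat_least n : P n -> le_enat (least P) (Some n).
Proof.
move=> Pn; case e : (least P) => [m|] /=.
  by have [_] := least_Some e; exact.
move: e; rewrite /least; case: pselect => // -[]; exists n; exact/asboolP.
Qed.

Lemma least_neq_None : least P <> None -> exists n, P n.
Proof. by rewrite /least; case: pselect => // -[n /asboolP Pn] _; exists n. Qed.
End Least.

Section IdealPowers.
Variable R : pzRingType.

Section MulSet.
Variables (M : lmodType R) (A : set R) (B : set M).

(** Membership in a product is an existential over three finite families; induction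
    on sums of products spares their manipulation. *)
Lemma mul_set_ind (P : set M) :
  P 0 -> (forall x y, P x -> P y -> P (x + y)) ->
  (forall a x, A a -> B x -> P (a *: x)) -> forall x, mul_set A B x -> P x.
Proof.
move=> P0 PD PZ _ [n [a [x [Aa Bx ->]]]].
by apply: (big_ind P) => // i _; exact: PZ.
Qed.

Lemma mul_set0 : mul_set A B 0.
Proof.
exists 0%N, (fun=> 0), (fun=> 0).
by split=> [[]//|[]//|]; rewrite big_ord0.
Qed.

Lemma mul_set_scale a x : A a -> B x -> mul_set A B (a *: x).
Proof.
by move=> Aa Bx; exists 1%N, (fun=> a), (fun=> x); split=> //; rewrite big_ord1.
Qed.

Lemma mul_setD x y : mul_set A B x -> mul_set A B y -> mul_set A B (x + y).
Proof.
move=> [n [b [u [Ab Bu ->]]]] [m [c [v [Ac Bv ->]]]].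
exists (n + m)%N,
  (fun i => match fintype.split i with inl j => b j | inr j => c j end),
  (fun i => match fintype.split i with inl j => u j | inr j => v j end).
split=> [i|i|]; try by case: fintype.split.
rewrite big_split_ord /=; congr (_ + _); apply: eq_bigr => i _.
  by rewrite (unsplitK (inl i : 'I_n + 'I_m)).
by rewrite (unsplitK (inr i : 'I_n + 'I_m)).
Qed.
End MulSet.

Variable A : set R.

Lemma pow_idealMr t a b : pow_ideal A t a -> pow_ideal A t (a * b).
Proof.
elim: t a => [//|t IH] a.
  apply: (@mul_set_ind R^o A _ (fun a => pow_ideal A t.+1 (a * b))).
- by rewrite mul0r; exact: mul_set0.
- by move=> x y hx hy; rewrite mulrDl; exact: mul_setD.
- move=> x y Ax hy; rewrite -mulrA.
  by apply: (@mul_set_scale R^o) => //; exact: IH.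
Qed.

Hypothesis A_lideal : forall a b, A b -> A (a * b).

(** Powers are defined by multiplying on the left; this is the passage to the right. *)
Lemma pow_idealSr t a b : pow_ideal A t a -> A b -> pow_ideal A t.+1 (a * b).
Proof.
elim: t a => [|t IH] a.
  move=> _ Ab; rewrite -[a * b]mulr1.
  by apply: (@mul_set_scale R^o) => //; exact: A_lideal.
move=> ha Ab; move: ha.
apply: (@mul_set_ind R^o A _ (fun a => pow_ideal A t.+2 (a * b))).
- by rewrite mul0r; exact: mul_set0.
- by move=> x y hx hy; rewrite mulrDl; exact: mul_setD.
- move=> x y Ax hy; rewrite -mulrA.
  by apply: (@mul_set_scale R^o) => //; exact: IH.
Qed.

Lemma mul_set_pow (M : lmodType R) t a (x : M) :
  pow_ideal A t a -> mul_set A setT x -> mul_set (pow_ideal A t.+1) setT (a *: x).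
Proof.
move=> ha.
  apply: (@mul_set_ind M A _ (fun x => mul_set (pow_ideal A t.+1) setT (a *: x))).
- by rewrite scaler0; exact: mul_set0.
- by move=> u v hu hv; rewrite scalerDr; exact: mul_setD.
- by move=> b u Ab _; rewrite scalerA; apply: mul_set_scale => //; exact: pow_idealSr.
Qed.
End IdealPowers.

(** * Split basic algebras with nilpotent radical *)

(** A basic algebra split over [k]: the quotient by the common kernel of the
    characters [chi], which is nilpotent, is a product of copies of [k], and the
    idempotents lift those of the product.  This is all that the first bound uses
    of a bound quiver algebra. *)
Record split_basic (k : fieldType) (L : pzRingType) (V : finType) := SplitBasic {
  sc : {rmorphism k -> L};
  scC : forall x a, sc x * a = a * sc x;
  chi : V -> {rmorphism L -> k};
  chi_sc : forall i x, chi i (sc x) = x;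
  idem : V -> L;
  chi_idem : forall i j, chi j (idem i) = (i == j)%:R;
  idemM : forall i j, idem i * idem j = if i == j then idem i else 0;
  idem_sum : \sum_i idem i = 1;
  chi_nil : exists m, forall a,
    pow_ideal [set b | forall i, chi i b = 0] m a -> a = 0
}.

Section SplitBasic.
Variables (k : fieldType) (L : pzRingType) (V : finType).
Variable S : split_basic k L V.
Local Notation sc := (sc S).
Local Notation chi := (chi S).
Local Notation idem := (idem S).

Let N : set L := [set a | forall i, chi i a = 0].

Fact chi_ker_lideal a b : N b -> N (a * b).
Proof. by move=> Nb i; rewrite rmorphM Nb mulr0. Qed.

Lemma pow_ideal_expr a t : N a -> pow_ideal N t (a ^+ t).
Proof.
move=> Na; elim: t => [//|t IH].
by rewrite exprS; apply: (@mul_set_scale L^o).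
Qed.

(** A proper left ideal together with a nilpotent left ideal stays proper: from
    1 = u + b a one gets 1 = u v for a polynomial expression v in b a. *)
Lemma chi_ker_jacobson a : N a -> jacobson a.
Proof.
move=> Na m [m1 mmax]; apply: contrapT => nam.
pose P : {pred L^o} := fun x => `[< exists u b, u \in m /\ x = u + b * a >].
have Pc : submod_closed P.
  split; first by apply/asboolP; exists 0, 0; rewrite rpred0 mul0r addr0.
  move=> c x y /asboolP[u [b [um ->]]] /asboolP[v [d [vm ->]]]; apply/asboolP.
  exists (c * u + v), (c * b + d); split.
    by rewrite rpredD //; apply: (@rpredZ L L^o m).
  by rewrite scalerDr addrACA mulrDl -mulrA.
pose PM := GRing.isSubmodClosed.Build L L^o P Pc.
pose P' : submodClosed L^o := HB.pack P PM.
have mP : {subset m <= P'}.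
  by move=> x xm; apply/asboolP; exists x, 0; rewrite mul0r addr0.
have aP : a \in P' by apply/asboolP; exists 0, 1; rewrite rpred0 mul1r add0r.
case: (boolP (1 \in P')) => [/asboolP[u [b [um e]]]|nP]; last first.
  by apply: nam; rewrite -(mmax P').
have [t nil] := chi_nil S.
have ba0 : (b * a) ^+ t = 0 by apply/nil/pow_ideal_expr/chi_ker_lideal.
have uE : u = 1 - b * a by rewrite e addrK.
case/negP: m1; rewrite -[1]subr0 -ba0 {nil ba0}.
elim: t => [|t IH]; first by rewrite expr0 subrr rpred0.
have -> : 1 - (b * a) ^+ t.+1 = (b * a) ^+ t * u + (1 - (b * a) ^+ t).
  by rewrite uE mulrBr mulr1 -exprSr [RHS]addrC addrA subrK.
by rewrite rpredD //; apply: (@rpredZ L L^o m).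
Qed.

(** The kernel of a character is a maximal left ideal, as it has codimension one. *)
Lemma chi_jacobson a i : jacobson a -> chi i a = 0.
Proof.
pose P : {pred L^o} := fun x => chi i x == 0.
have Pc : submod_closed P.
  split; first by apply/eqP; rewrite rmorph0.
  move=> c x y /eqP hx /eqP hy; apply/eqP.
  by rewrite rmorphD rmorphM hx hy mulr0 addr0.
pose PM := GRing.isSubmodClosed.Build L L^o P Pc.
pose P' : submodClosed L^o := HB.pack P PM.
move=> /(_ P') Ja; apply/eqP/Ja; split.
  by apply/negP => /eqP; rewrite rmorph1; apply/eqP/oner_neq0.
move=> n Pn n1 x; apply/idP/idP => [xn|]; last exact: Pn.
apply: contraT => cx; case/negP: n1.
have cx0 : chi i x != 0 by [].
have -> : 1 = (1 - sc (chi i x)^-1 * x) + sc (chi i x)^-1 * x by rewrite subrK.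
rewrite rpredD //; last by apply: (@rpredZ L L^o n).
by apply: Pn; apply/eqP; rewrite rmorphB rmorphM rmorph1 chi_sc mulVf // subrr.
Qed.

Lemma jacobsonP a : jacobson a <-> forall i, chi i a = 0.
Proof. by split=> [Ja i|/chi_ker_jacobson//]; exact: chi_jacobson. Qed.

Lemma jacobson_nil : exists m, forall a, pow_ideal (@jacobson L) m a -> a = 0.
Proof.
have [m nil] := chi_nil S; exists m => a; suff -> : @jacobson L = N by exact: nil.
by apply/seteqP; split=> b /jacobsonP.
Qed.

Lemma jacobson_lideal a b : jacobson b -> jacobson (a * b : L).
Proof. exact: jacobsonM. Qed.

Section JacKilled.
Variable M : lmodType L.

(** Modules over the semisimple quotient: for a semiprimary ring these are exactly
    the semisimple modules. *)
Definition jac_killed := forall a (x : M), jacobson a -> a *: x = 0.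

Hypothesis JM : jac_killed.

Lemma act_idem i a (x : M) : a *: (idem i *: x) = sc (chi i a) *: (idem i *: x).
Proof.
apply/subr0_eq; rewrite -scalerBl scalerA; apply: JM; apply/jacobsonP => j.
rewrite rmorphM rmorphB chi_sc chi_idem; case: eqP => [->|_]; last by rewrite mulr0.
by rewrite subrr mul0r.
Qed.

Lemma idem_act i a (x : M) : idem i *: (a *: x) = sc (chi i a) *: (idem i *: x).
Proof.
apply/subr0_eq; rewrite !scalerA -scalerBl; apply: JM; apply/jacobsonP => j.
rewrite rmorphB !rmorphM chi_sc chi_idem; case: eqP => [->|_].
  by rewrite mulr1 mul1r subrr.
by rewrite mul0r mulr0 subrr.
Qed.

Lemma idem_decomp (x : M) : x = \sum_i idem i *: x.
Proof. by rewrite -scaler_suml idem_sum scale1r. Qed.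
End JacKilled.

Lemma rad_predP (M : lmodType L) (x : M) :
  x \in @rad_pred L M <-> mul_set (@jacobson L) setT x.
Proof. by split=> [/asboolP|h]; last exact/asboolP. Qed.

Lemma top_killed (M : lmodType L) : jac_killed (top_mod M).
Proof.
have [p [sp p0]] := quot_mod_linear (@rad_pred L M).
move=> a x Ja; have [y <-] := sp x.
by rewrite -linearZ; apply/p0/rad_predP; exact: mul_set_scale.
Qed.

Lemma jac_killed_rad (M M' : lmodType L) (f : {linear M -> M'}) x :
  jac_killed M' -> mul_set (@jacobson L) setT x -> f x = 0.
Proof.
move=> JM'; apply: (mul_set_ind (P := fun x => f x = 0)).
- exact: linear0.
- by move=> u v fu fv; rewrite linearD fu fv addr0.
- by move=> a u Ja _; rewrite linearZ; exact: JM'.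
Qed.

(** Choose a functional [lam] on the top of [M] with value 1 at the class of [x].  The
    map [y |-> lam (idem i *: y) *: s] is linear over the algebra because both the
    component of the top at [i] and the line of [s] are acted upon through [chi i]. *)
Lemma hom_to_semisimple (M M' : lmodType L) i (x : M) (s : M') :
  idem i *: x = x -> ~ mul_set (@jacobson L) setT x ->
  jac_killed M' -> idem i *: s = s ->
  exists f : {linear M -> M'}, f x = s.
Proof.
move=> ex nx JM' es.
have [p [sp p0]] := quot_mod_linear (@rad_pred L M).
have [|lam lamx] := @functional_neq0 k (rscal sc (top_mod M)) (p x).
  by move/p0/rad_predP.
have [|f fE] := @linear_of L M M' (fun y => sc (lam (idem i *: p y)) *: s).
  move=> a y z; rewrite linearP scalerDr idem_act; last exact: top_killed.
  have /= -> := linearP lam (chi i a) (idem i *: p y) (idem i *: p z).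
  rewrite rmorphD scalerDl; congr (_ + _).
  rewrite -[in RHS]es !scalerA -scC -[in RHS]scalerA act_idem // es.
  by rewrite rmorphM chi_sc [in RHS]mulrC.
by exists f; rewrite fE -linearZ ex lamx rmorph1 scale1r.
Qed.
End SplitBasic.

(** * Maximal Loewy length and lifting modulo the radical *)

Section LoewyLift.
Variables (k : fieldType) (L : pzRingType) (V : finType).
Variable S : split_basic k L V.
Local Notation sc := (sc S).
Local Notation chi := (chi S).
Local Notation idem := (idem S).
Local Notation J := (@jacobson L).

Lemma jac_pow_zero t (M : lmodType L) (x : M) :
  (forall a, pow_ideal J t a -> a = 0) -> mul_set (pow_ideal J t) setT x -> x = 0.
Proof.
move=> nil; apply: (mul_set_ind (P := fun x => x = 0)) => // [y z -> ->|a y /nil -> _].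
  by rewrite addr0.
by rewrite scale0r.
Qed.

(** In the second case [t.+1] is the Loewy length of the algebra, and of the
    projective at [i]. *)
Lemma non_maximal_or_pow_neq0 i : ~ maximal_loewy_length (left_mul_mod (idem i)) \/
  exists t, (forall a, pow_ideal J t.+1 a -> a = 0) /\
            (exists2 a, pow_ideal J t a & a * idem i <> 0).
Proof.
have [mx|] := pselect (maximal_loewy_length (left_mul_mod (idem i))); last by left.
right; move: mx; rewrite /maximal_loewy_length /loewy_length.
set Q := fun t => _ = [set 0 : L^o]; set P := (fun t => _); move=> PQ.
(* The least exponent for the algebra is positive as idem i is not zero. *)
have idem0 : idem i <> 0.
  move=> e; have := congr1 (chi i) e; rewrite chi_idem eqxx rmorph0.
  exact/eqP/oner_neq0.
have e_in : idem i \in left_mul_pred (idem i) by apply/asboolP; exists 1; rewrite mul1r.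
pose e : left_mul_mod (idem i) := exist _ (idem i : L^o) e_in.
have Q0 t : Q t -> forall a, pow_ideal J t a -> a = 0.
  move=> Qt a ha; have : mul_set (pow_ideal J t) [set: L^o] (a *: (1 : L^o)).
    exact: mul_set_scale.
  by rewrite Qt /GRing.scale /= mulr1.
case Ql : (least Q) => [[|t]|].
- rewrite Ql in PQ; have [P0 _] := least_Some PQ.
  have : mul_set (pow_ideal J 0) [set: left_mul_mod (idem i)] ((1 : L) *: e).
    exact: mul_set_scale.
  by rewrite P0 scale1r => /(congr1 val) /= /idem0.
- exists t; have [Qt _] := least_Some Ql; split; first exact: Q0.
  apply: contrapT => na; rewrite Ql in PQ; have [_ minP] := least_Some PQ.
  have /minP : P t; last by rewrite ltnn.
  apply/seteqP; split=> [x|_ ->]; last exact: mul_set0.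
  apply: (mul_set_ind (P := fun x => x = 0)) => // [y z -> ->|a [y hy] ha _].
    by rewrite addr0.
  apply: val_inj; have /asboolP[b yE] := hy.
  apply: contrapT => nz; apply: na; exists (a * b); first exact: pow_idealMr.
  by rewrite -mulrA -yE.
- have [m nil] := jacobson_nil S.
  have := @le_enat_least Q m; rewrite Ql /= => notQ; case: notQ.
  apply/seteqP; split=> [x|_ ->]; first exact: jac_pow_zero.
  exact: mul_set0.
Qed.

(** If [q \o i] is the identity modulo the t-th power of the radical, then
    [r + q - r i q] has this property for the next power, as the error is
    [- (r i - 1)] applied to the error of [q]. *)
Lemma retract_mod_jac (A B : lmodType L) (i : {linear A -> B}) (r : {linear B -> A}) :
  (forall x, mul_set J setT (r (i x) - x)) ->
  exists r' : {linear B -> A}, forall x, r' (i x) = x.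
Proof.
move=> rJ.
suff lift t : exists q : {linear B -> A}, forall x,
    mul_set (pow_ideal J t) setT (q (i x) - x).
  have [m nil] := jacobson_nil S; have [q qE] := lift m.
  by exists q => x; apply/subr0_eq/(jac_pow_zero nil).
elim: t => [|t [q qE]].
  by exists \0 => x; rewrite -[_ - _]scale1r; apply: mul_set_scale.
exists (r \+ (q \- (r \o i \o q))) => x /=.
set z := q (i x); set y := r (i x).
have -> : y + (z - r (i z)) - x = (-1) *: (r (i (z - x)) - (z - x)).
  rewrite scaleN1r opprB (linearB i) (linearB r) -/y opprB addrACA !addrA.
  by rewrite [y + z]addrC [LHS]addrAC.
have := qE x; rewrite -/z.
apply: (@mul_set_ind _ A _ _
  (fun w => mul_set (pow_ideal J t.+1) setT ((-1) *: (r (i w) - w)))).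
- by rewrite (linear0 i) (linear0 r) subrr scaler0; exact: mul_set0.
- move=> u v hu hv; rewrite (linearD i) (linearD r) opprD addrACA scalerDr.
  exact: mul_setD.
- move=> a u ha _; rewrite !linearZ /= -scalerDr scalerA.
  rewrite mulN1r -mulrN1; apply: mul_set_pow => //; last exact: pow_idealMr.
  by move=> c d; exact: jacobsonM.
Qed.
End LoewyLift.

(** * Descent of the projective dimension *)

Section Descent.
Variables (k : fieldType) (L : pzRingType) (V : finType).
Variable S : split_basic k L V.
Local Notation sc := (sc S).
Local Notation chi := (chi S).
Local Notation idem := (idem S).
Local Notation J := (@jacobson L).

Definition non_maximal i := ~ maximal_loewy_length (left_mul_mod (idem i)).

(** [T] is killed by the radical and contains the simple module at [i], as the line
    of [s]. *)
Definition detects i (T : lmodType L) :=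
  jac_killed T /\ exists2 s : T, s <> 0 & idem i *: s = s.

(** The heart of the argument: an element of [P1] that leaves the radical of [P1] but
    falls into that of [P0] can sit neither at a non-maximal vertex, where a map to
    [T] would not extend, nor at a maximal one, where it would be annihilated by
    too small a power of the radical. *)
Lemma top_map_injective (P1 P0 M : lmodType L) (i : {linear P1 -> P0})
    (p : {linear P0 -> M}) :
  short_exact i p -> projective P1 ->
  (forall j, non_maximal j -> exists2 T, detects j T & ext1_zero M T) ->
  forall x, mul_set J setT (i x) -> mul_set J setT x.
Proof.
move=> ip Pp hT x ix; have [ii exP sp] := ip.
apply/rad_predP; rewrite (idem_decomp S x); apply: rpred_sum => j _; apply/rad_predP.
set y := idem j *: x; apply: contrapT => ny.
have ey : idem j *: y = y by rewrite scalerA idemM eqxx.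
have iy : mul_set J setT (i y).
  rewrite linearZ; apply/rad_predP; apply: rpredZ; exact/rad_predP.
have [nm|[t [nil [a ha ae]]]] := non_maximal_or_pow_neq0 S j.
  have [T [JT [s s0 es]] ext] := hT j nm.
  have [f fy] := hom_to_semisimple ey ny JT es.
  have [h hE] := ext _ _ _ _ ip f.
  by apply: s0; rewrite -fy -hE; exact: jac_killed_rad JT iy.
(* At a maximal vertex, map to the top of the algebra itself, so that the map
   lifts to the algebra. *)
have [q [sq q0]] := quot_mod_linear (@rad_pred L L^o).
have JT : jac_killed (top_mod L^o) by exact: top_killed.
have es : idem j *: q (idem j) = q (idem j).
  by rewrite -linearZ /= /GRing.scale /= idemM eqxx.
have [f fy] := hom_to_semisimple ey ny JT es.
have [h hE] := Pp _ _ q f sq.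
have : mul_set J setT (h y - idem j).
  by apply/rad_predP/q0; rewrite linearB /= hE fy subrr.
move=> /(mul_set_pow (@jacobson_lideal L) ha)/(jac_pow_zero nil).
rewrite scalerBr -linearZ => e; apply: ae.
have ay : a *: y = 0.
  apply: ii; rewrite linear0 linearZ /=; apply: (jac_pow_zero nil).
  exact: (mul_set_pow (@jacobson_lideal L) ha iy).
by move: e; rewrite ay linear0 sub0r => /eqP; rewrite oppr_eq0 => /eqP.
Qed.

(** A linear retraction [h] of tops over [k] is made linear over the algebra by taking
    its diagonal components [idem j * h * idem j]. *)
Lemma splits_of_top_injective (P1 P0 : lmodType L) (i : {linear P1 -> P0}) :
  projective P0 -> (forall x, mul_set J setT (i x) -> mul_set J setT x) ->
  exists r : {linear P0 -> P1}, forall x, r (i x) = x.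
Proof.
move=> P0p ti.
have [p1 [s1 k1]] := quot_mod_linear (@rad_pred L P1).
have [p0 [s0 k0]] := quot_mod_linear (@rad_pred L P0).
have J1 : jac_killed (top_mod P1) by exact: top_killed.
have J0 : jac_killed (top_mod P0) by exact: top_killed.
have [|ti0 tiE] := @factor_surj _ _ _ _ p1 (p0 \o i : {linear P1 -> top_mod P0}) s1.
  move=> y /k1/rad_predP Jy; exact: jac_killed_rad J0 _.
have [ti1 ti1E] := rscal_linear sc ti0.
have [|h hE] := @vspace_injective k (rscal sc (top_mod P1)) _ _ ti1 idfun.
  apply: linear_inj => z; rewrite ti1E; have [y <-] := s1 z.
  by rewrite tiE => /k0/rad_predP/ti/rad_predP/k1.
have [|q qE] := @linear_of L P0 (top_mod P1)
    (fun y => \sum_j idem j *: (h (idem j *: p0 y) : top_mod P1)).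
  move=> a y z; rewrite linearP scaler_sumr -big_split /=; apply: eq_bigr => j _.
  rewrite scalerDr (idem_act S J0 j a).
  have /= -> := linearP h (chi j a) (idem j *: p0 y) (idem j *: p0 z).
  rewrite scalerDr; congr (_ + _).
  by rewrite rscalE (idem_act S J1) chi_sc [RHS](act_idem S J1).
have [r rE] := P0p _ _ p1 q s1.
apply: (@retract_mod_jac _ _ _ S _ _ i r) => x.
apply/rad_predP/k1; rewrite linearB /= rE qE.
rewrite [X in X - _](_ : _ = p1 x) ?subrr //.
rewrite [RHS](idem_decomp S); apply: eq_bigr => j _.
have <- : ti0 (p1 x) = p0 (i x) by exact: tiE.
rewrite -[idem j *: ti0 _]linearZ -ti1E hE /=.
by rewrite scalerA idemM eqxx.
Qed.

Lemma pd_le_descent (n : nat) (M : lmodType L) :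
  (forall j, non_maximal j -> exists2 T, detects j T & ext_zero n M T) ->
  pd_le n.+1 M -> pd_le n M.
Proof.
elim: n M => [|n IH] M hT [K [P [i [p [ip Pp Kp]]]]].
  have [ii ex sp] := ip.
  have ti := top_map_injective ip Kp hT.
  have [r rE] := splits_of_top_injective Pp ti.
  have [||s sE] := @factor_surj _ _ _ P p (idfun \- (i \o r)) => //.
    by move=> y /ex[x <-] /=; rewrite rE subrr.
  apply: (@projective_retract _ _ _ s p) Pp => x; have [y <-] := sp x.
  rewrite sE /= linearB /= [X in _ - X](_ : _ = 0) ?subr0 //.
  by apply/ex; eexists.
exists K, P, i, p; split=> //; apply: IH Kp => j /hT[T dT ext].
by exists T => //; exact: ext ip Pp.
Qed.

(** The module that detects a vertex may depend on the vertex; only the bound on its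
    injective dimension is common. *)
Lemma big_findim_le d :
  (forall j, non_maximal j -> exists2 T, detects j T &
     exists2 d', (d' <= d)%N & id_le d' T) ->
  le_enat (big_findim L) (Some d).
Proof.
move=> hT; apply: le_enat_least => M /least_neq_None[n].
rewrite proj_resolutionP; elim: n => [|n IH] pdM.
  case e : (projdim M) => [m|].
    have [_ /(_ 0%N)] := least_Some e; rewrite proj_resolutionP leqn0.
    by move=> /(_ pdM)/eqP->.
  have := le_enat_least (proj2 (proj_resolutionP M 0) pdM).
  by rewrite -/(projdim M) e.
have [dn|nd] := leqP d n.
  apply: IH; apply: pd_le_descent pdM => j /hT[T dT [d' d'd idT]].
  by exists T => //; exact: id_le_ext_zero idT (leq_trans d'd dn).
have := le_enat_least (proj2 (proj_resolutionP M n.+1) pdM).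
rewrite -/(projdim M); case: (projdim M) => //= m mn.
exact: leq_trans mn nd.
Qed.
End Descent.

(** * Duality over the ground field *)

(** Modules over [L^c^c] are not convertible to modules over [L], so the duality is set
    up for two rings with an anti-isomorphism between them, a situation which is
    symmetric ([flip]). *)
Record opposite_pair (k : fieldType) (R R' : pzRingType) := OppositePair {
  scl : {rmorphism k -> R};
  scr : {rmorphism k -> R'};
  to_op : R -> R';
  of_op : R' -> R;
  to_opK : cancel to_op of_op;
  of_opK : cancel of_op to_op;
  to_opD : {morph to_op : a b / a + b};
  to_opM : forall a b, to_op (a * b) = to_op b * to_op a;
  to_op_sc : forall x, to_op (scl x) = scr x;
  sclC : forall x a, scl x * a = a * scl x
}.

Section OppositePair.
Variables (k : fieldType) (R R' : pzRingType) (D : opposite_pair k R R').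

Lemma of_opD : {morph of_op D : a b / a + b}.
Proof. by move=> a b; apply: (can_inj (to_opK D)); rewrite to_opD !of_opK. Qed.

Lemma of_opM a b : of_op D (a * b) = of_op D b * of_op D a.
Proof. by apply: (can_inj (to_opK D)); rewrite to_opM !of_opK. Qed.

Lemma of_op_sc x : of_op D (scr D x) = scl D x.
Proof. by rewrite -to_op_sc to_opK. Qed.

Lemma of_op1 : of_op D 1 = 1.
Proof. by rewrite -[1](rmorph1 (scr D)) of_op_sc rmorph1. Qed.

Lemma scrC x a : scr D x * a = a * scr D x.
Proof. by apply: (can_inj (of_opK D)); rewrite !of_opM of_op_sc sclC. Qed.

Definition flip : opposite_pair k R' R := @OppositePair k R' R
  (scr D) (scl D) (of_op D) (to_op D) (of_opK D) (to_opK D) of_opD of_opM of_op_sc scrC.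
End OppositePair.

Section HomModule.
Variables (k : fieldType) (R R' : pzRingType) (D : opposite_pair k R R').
Variables (M : lmodType R) (V : lmodType k).

(** The [k]-linear maps from [M] to [V]; with the action of [R] on the argument they
    form a module over [R']. *)
Definition hom_pred : {pred (M -> V)} := fun f =>
  `[< forall a u v, f (scl D a *: u + v) = a *: f u + f v >].

Fact hom_zmod_closed : zmod_closed hom_pred.
Proof.
split; first by apply/asboolP => a u v; rewrite /= scaler0 addr0.
move=> f g /asboolP hf /asboolP hg; apply/asboolP => a u v.
by rewrite !fctE hf hg opprD addrACA scalerBr.
Qed.
HB.instance Definition _ := GRing.isZmodClosed.Build (M -> V) hom_pred
  hom_zmod_closed.

Definition hom_mod := {f : M -> V | f \in hom_pred}.
HB.instance Definition _ := SubChoice.on hom_mod.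
HB.instance Definition _ := [SubChoice_isSubZmodule of hom_mod by <:].

Definition hom_app (f : hom_mod) : M -> V := val f.

Lemma hom_appP (f : hom_mod) a u v :
  hom_app f (scl D a *: u + v) = a *: hom_app f u + hom_app f v.
Proof. by have /asboolP := valP f; apply. Qed.

Lemma hom_ext (f g : hom_mod) : hom_app f =1 hom_app g -> f = g.
Proof. by move=> e; apply/val_inj/funext. Qed.

Lemma hom_of (f : M -> V) :
  (forall a u v, f (scl D a *: u + v) = a *: f u + f v) ->
  exists h : hom_mod, hom_app h = f.
Proof.
move=> hf.
by exists (exist (fun f => f \in hom_pred) f (introT (asboolP _) hf)).
Qed.

Lemma hom_appD f g x : hom_app (f + g) x = hom_app f x + hom_app g x.
Proof. by []. Qed.

Lemma hom_appr0 (f : hom_mod) : hom_app f 0 = 0.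
Proof.
have := hom_appP f (-1) 0 0; rewrite scaler0 addr0 scaleN1r addNr.
by [].
Qed.

Lemma hom_apprD (f : hom_mod) u v : hom_app f (u + v) = hom_app f u + hom_app f v.
Proof. by have := hom_appP f 1 u v; rewrite rmorph1 !scale1r. Qed.

Lemma hom_apprZ (f : hom_mod) a u : hom_app f (scl D a *: u) = a *: hom_app f u.
Proof. by have := hom_appP f a u 0; rewrite hom_appr0 !addr0. Qed.

Fact hom_scale_hom (a : R') (f : hom_mod) :
  (fun x => hom_app f (of_op D a *: x)) \in hom_pred.
Proof.
by apply/asboolP => b u v; rewrite scalerDr scalerA -sclC -scalerA hom_appP.
Qed.

Definition hom_scale (a : R') (f : hom_mod) : hom_mod :=
  exist (fun f => f \in hom_pred) _ (hom_scale_hom a f).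

Lemma hom_scaleE a f x : hom_app (hom_scale a f) x = hom_app f (of_op D a *: x).
Proof. by []. Qed.

Fact hom_scaleA a b f : hom_scale a (hom_scale b f) = hom_scale (a * b) f.
Proof. by apply: hom_ext => x; rewrite !hom_scaleE of_opM scalerA. Qed.

Fact hom_scale1 : left_id 1 hom_scale.
Proof. by move=> f; apply: hom_ext => x; rewrite hom_scaleE of_op1 scale1r. Qed.

Fact hom_scaleDr : right_distributive hom_scale +%R.
Proof. by move=> a f g; apply: hom_ext. Qed.

Fact hom_scaleDl f : {morph hom_scale^~ f : a b / a + b}.
Proof.
move=> a b; apply: hom_ext => x.
by rewrite hom_appD !hom_scaleE of_opD scalerDl hom_apprD.
Qed.

HB.instance Definition _ := GRing.Zmodule_isLmodule.Build R' hom_mod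
  hom_scaleA hom_scale1 hom_scaleDr hom_scaleDl.

Lemma hom_appZ a (f : hom_mod) x : hom_app (a *: f) x = hom_app f (of_op D a *: x).
Proof. by []. Qed.

Lemma hom_app_sum (I : Type) (s : seq I) (F : I -> hom_mod) x :
  hom_app (\sum_(i <- s) F i) x = \sum_(i <- s) hom_app (F i) x.
Proof. by apply: (big_morph (fun f => hom_app f x)). Qed.

Lemma hom_appr_sum (I : Type) (s : seq I) (f : hom_mod) (F : I -> M) :
  hom_app f (\sum_(i <- s) F i) = \sum_(i <- s) hom_app f (F i).
Proof. by apply: (big_morph (hom_app f)); [exact: hom_apprD|exact: hom_appr0]. Qed.
End HomModule.

Section HomFunctor.
Variables (k : fieldType) (R R' : pzRingType) (D : opposite_pair k R R').
Variable V : lmodType k.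
Local Notation hom M := (hom_mod D M V).

Lemma hom_pre (M N : lmodType R) (g : {linear M -> N}) :
  exists h : {linear hom N -> hom M}, forall f x, hom_app (h f) x = hom_app f (g x).
Proof.
have [|s sE] := @choice (hom N) (hom M) (fun f h => hom_app h = hom_app f \o g).
  by move=> f; apply: hom_of => a u v /=; rewrite linearP hom_appP.
have [|h hE] := @linear_of R' (hom N) (hom M) s.
  move=> a f f'; apply: hom_ext => x.
  by rewrite hom_appD hom_appZ !sE /= hom_appD hom_appZ linearZ.
by exists h => f x; rewrite hE sE.
Qed.

Lemma hom_linear (M : lmodType R) (f : hom M) :
  exists g : {linear rscal (scl D) M -> V}, forall x, g x = hom_app f x.
Proof. by apply: linear_of => a x y; exact: hom_appP. Qed.

Lemma linear_hom (M : lmodType R) (g : {linear rscal (scl D) M -> V}) :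
  exists f : hom M, forall x, hom_app f x = g x.
Proof.
have [|f fE] := @hom_of _ _ _ D M V g; last by exists f => x; rewrite fE.
by move=> a x y; exact: linearP.
Qed.

Lemma hom_pre_onto (A B : lmodType R) (i : {linear A -> B}) : injective i ->
  exists h : {linear hom B -> hom A},
    (forall f x, hom_app (h f) x = hom_app f (i x)) /\ onto h.
Proof.
move=> ii; have [h hE] := hom_pre i; exists h; split=> // f.
have [ik ikE] := rscal_linear (scl D) i; have [fk fkE] := hom_linear f.
have [|g gE] := @vspace_injective _ _ _ _ ik fk.
  by move=> x y; rewrite !ikE => /ii.
have [f' f'E] := linear_hom g; exists f'; apply: hom_ext => x.
by rewrite hE f'E -ikE gE fkE.
Qed.

Lemma hom_short_exact (A B C : lmodType R) (i : {linear A -> B})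
    (p : {linear B -> C}) :
  short_exact i p ->
  exists (p' : {linear hom C -> hom B}) (i' : {linear hom B -> hom A}),
    short_exact p' i'.
Proof.
move=> [ii ex sp]; have [p' p'E] := hom_pre p.
have [i' [i'E si']] := hom_pre_onto ii.
have [pk pkE] := rscal_linear (scl D) p.
exists p', i'; split=> //.
  move=> f f' e; apply: hom_ext => z; have [y <-] := sp z.
  by rewrite -!p'E e.
move=> f; split=> [f0|[g <-]].
  have [fk fkE] := hom_linear f.
  have [||g gE] := @factor_surj _ _ _ _ pk fk.
  - by move=> z; have [y <-] := sp z; exists y; rewrite pkE.
  - move=> y; rewrite pkE fkE => /ex[x <-].
    by rewrite -i'E f0.
  have [h hE] := linear_hom g; exists h; apply: hom_ext => x.
  by rewrite p'E hE -pkE gE fkE.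
apply: hom_ext => x; rewrite i'E p'E.
by have -> : p (i x) = 0; [apply/ex; exists x|rewrite hom_appr0].
Qed.

(** Maps [A -> Hom(M,V)] and [M -> Hom(A,V)] both are the [k]-bilinear maps on [A] and
    [M] that are balanced over [R]. *)
Lemma hom_transpose (A : lmodType R') (M : lmodType R) (f : {linear A -> hom M}) :
  exists g : {linear M -> hom_mod (flip D) A V},
    forall x a, hom_app (g x) a = hom_app (f a) x.
Proof.
have [|s sE] := @choice M (hom_mod (flip D) A V)
    (fun x h => hom_app h = fun a => hom_app (f a) x).
  move=> x; apply: hom_of => a u v /=.
  by rewrite linearP hom_appD hom_appZ of_op_sc hom_apprZ.
have [|g gE] := @linear_of R M (hom_mod (flip D) A V) s.
  move=> a x y; apply: hom_ext => u.
  by rewrite hom_appD hom_appZ !sE /= linearZ /= hom_apprD hom_appZ to_opK.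
by exists g => x a; rewrite gE sE.
Qed.

(** The inverse transposition; [hom_transpose] for [flip D] would end in a module over
    [flip (flip D)], which is not convertible to [D]. *)
Lemma hom_untranspose (A : lmodType R') (M : lmodType R)
    (g : {linear M -> hom_mod (flip D) A V}) :
  exists f : {linear A -> hom M},
    forall x a, hom_app (f a) x = hom_app (g x) a.
Proof.
have [|s sE] := @choice A (hom M) (fun a h => hom_app h = fun x => hom_app (g x) a).
  move=> a; apply: hom_of => c u v /=.
  by rewrite linearP hom_appD hom_appZ /= to_op_sc hom_apprZ.
have [|f fE] := @linear_of R' A (hom M) s.
  move=> c a b; apply: hom_ext => u.
  by rewrite hom_appD hom_appZ !sE /= linearZ /= hom_apprD hom_appZ /= of_opK.
by exists f => x a; rewrite fE sE.
Qed.
End HomFunctor.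

Section Dual.
Variables (k : fieldType) (R R' : pzRingType) (D : opposite_pair k R R').

Definition dual (M : lmodType R) : lmodType R' := hom_mod D M k^o.

(** Functionals separate points.  In infinite dimension the map is not onto, but an
    embedding is all that is needed to find a simple submodule in the bidual. *)
Lemma bidual (M : lmodType R) :
  exists f : {linear M -> hom_mod (flip D) (dual M) k^o}, injective f.
Proof.
have [f fE] := @hom_transpose _ _ _ D k^o (dual M) M idfun.
exists f; apply: linear_inj => x fx; apply: contrapT => x0.
have [g gx] := @functional_neq0 k (rscal (scl D) M) x x0.
have [|h hE] := @hom_of _ _ _ D M k^o g; first by move=> a u v; exact: linearP.
have := fE x h; rewrite fx hE gx => /esym/eqP.
by rewrite oner_eq0.
Qed.
End Dual.

(** By transposition, extending [A -> D P] along [A -> B] amounts to lifting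
    [P -> D A] along the surjection [D B -> D A]. *)
Lemma dual_projective (k : fieldType) (R R' : pzRingType)
    (D : opposite_pair k R R') (P : lmodType R) :
  projective P -> injective_mod (dual D P).
Proof.
move=> Pp A B g f gi.
have [f' f'E] := hom_transpose f.
have [g' [g'E sg']] := hom_pre_onto (flip D) k^o gi.
have [u uE] := Pp _ _ g' f' sg'.
have [h hE] := hom_untranspose u.
exists h => a; apply: hom_ext => x.
by rewrite hE -g'E uE f'E.
Qed.

Section DualInjective.
Variables (k : fieldType) (R R' : pzRingType) (D : opposite_pair k R R').
Variables (I : finType) (b : I -> R) (beta : I -> R -> k).
Hypothesis betaP : forall j a x y,
  beta j (scl D a * x + y) = a * beta j x + beta j y.
Hypothesis dual_basis : forall a, a = \sum_j scl D (beta j a) * b j.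

Lemma beta0 j : beta j 0 = 0.
Proof. by have := betaP j (-1) 0 0; rewrite mulr0 addr0 mulN1r addNr. Qed.

Lemma betaZ j a x : beta j (scl D a * x) = a * beta j x.
Proof. by have := betaP j a x 0; rewrite !addr0 beta0 addr0. Qed.

Lemma beta_sum j (c : I -> k) (x : I -> R) :
  beta j (\sum_l scl D (c l) * x l) = \sum_l c l * beta j (x l).
Proof.
have bD x' y' : beta j (x' + y') = beta j x' + beta j y'.
  by have := betaP j 1 x' y'; rewrite rmorph1 !mul1r.
by rewrite (big_morph (beta j) bD (beta0 j)); apply: eq_bigr => l _; rewrite betaZ.
Qed.

(** An injective [E] is a direct summand of the coinduced module [C] of the [k]-linear
    maps from the ring to [E], via [io x = (r |-> r x)] with retraction [rho].  As the
    ring is finite-dimensional, [C] consists of tensors: [tens j v] is the map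
    [beta_j] times [v].  The dual of [C] is the free module on the vector space
    [D E]; in terms of [E] alone, this says that each functional [f] on [E] is the
    sum of the [b_j * comp j f], where [comp j f] is [f (rho (tens j _))].  So to
    lift [f : D E -> B] through [g], lift it linearly over [k] to [th], and send
    [x] to the sum of the [b_j * th (comp j x)]. *)
Lemma dual_injective (E : lmodType R) : injective_mod E -> projective (dual D E).
Proof.
move=> Ei.
pose C : lmodType R := hom_mod (flip D) R'^o (rscal (scl D) E).
have [|io0 io0E] := @choice E C (fun x h => hom_app h = fun r => of_op D r *: x).
  move=> x; apply: hom_of => a u v /=.
  by rewrite of_opD of_opM of_op_sc -sclC scalerDl -scalerA.
have [|io ioE'] := @linear_of R E C io0.
  move=> a x y; apply: hom_ext => r.
  rewrite hom_appD hom_appZ !io0E scalerDr /= scalerA.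
  by rewrite /GRing.scale /= of_opM to_opK.
have ioE x r : hom_app (io x) r = of_op D r *: x by rewrite ioE' io0E.
have ioi : injective io.
  by apply: linear_inj => x io0x; have := ioE x 1; rewrite io0x of_op1 scale1r.
have [rho rhoE] := Ei _ _ io idfun ioi.
have [|tens0 tens0E] := @choice (I * E) C
    (fun jv h => hom_app h =
       fun r => beta jv.1 (of_op D r) *: (jv.2 : rscal (scl D) E)).
  move=> [j v]; apply: hom_of => a u w /=.
  by rewrite of_opD of_opM of_op_sc -sclC betaP scalerDl scalerA.
pose tens j v := tens0 (j, v).
have tensE j v r : hom_app (tens j v) r = scl D (beta j (of_op D r)) *: v.
  by rewrite /tens tens0E.
have tensP j a u v : tens j (scl D a *: u + v) = scl D a *: tens j u + tens j v.
  apply: hom_ext => r; rewrite hom_appD hom_appZ !tensE scalerDr; congr (_ + _).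
  rewrite [of_op (flip D) _](to_op_sc D) {2}/GRing.scale /= of_opM of_op_sc -sclC betaZ.
  by rewrite mulrC rmorphM scalerA.
pose comp_pred (fj : dual D E * I) (h : dual D E) :=
  hom_app h = fun v => hom_app fj.1 (rho (tens fj.2 v)).
have [|comp0 comp0E] := @choice _ _ comp_pred.
  move=> [f j]; apply: hom_of => a u v /=.
  by rewrite tensP linearP hom_appP.
pose comp j f := comp0 (f, j).
have compE j f v : hom_app (comp j f) v = hom_app f (rho (tens j v)).
  by rewrite /comp comp0E.
have compL j a f f' : comp j (scr D a *: f + f') = scr D a *: comp j f + comp j f'.
  apply: hom_ext => v; rewrite hom_appD hom_appZ of_op_sc hom_apprZ !compE.
  by rewrite hom_appD hom_appZ of_op_sc hom_apprZ.
have comp_decomp f : f = \sum_j to_op D (b j) *: comp j f.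
  apply: hom_ext => x; rewrite hom_app_sum.
  rewrite -{1}[x]rhoE /= -[X in rho X](_ : \sum_j tens j (b j *: x) = _).
    rewrite linear_sum hom_appr_sum; apply: eq_bigr => j _.
    by rewrite hom_appZ to_opK compE.
  apply: hom_ext => r; rewrite hom_app_sum ioE [of_op D r]dual_basis scaler_suml.
  by apply: eq_bigr => j _; rewrite tensE scalerA.
have comp_act j a f : comp j (a *: f) =
    \sum_l scr D (beta j (b l * of_op D a)) *: comp l f.
  apply: hom_ext => v; rewrite hom_app_sum compE hom_appZ.
  rewrite -linearZ /= [X in rho X](_ : _ =
      \sum_l scl D (beta j (b l * of_op D a)) *: tens l v).
    rewrite linear_sum hom_appr_sum; apply: eq_bigr => l _.
    by rewrite hom_appZ of_op_sc linearZ !hom_apprZ compE.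
  apply: hom_ext => r; rewrite hom_app_sum hom_appZ tensE.
  rewrite [of_op (flip D) _]of_opK {2}/GRing.scale /= of_opM.
  rewrite {1}[of_op D r]dual_basis mulr_suml.
  rewrite (eq_bigr (fun l => scl D (beta l (of_op D r)) * (b l * of_op D a)));
    last by move=> l _; rewrite mulrA.
  rewrite beta_sum rmorph_sum scaler_suml; apply: eq_bigr => l _.
  rewrite hom_appZ tensE [of_op (flip D) _](to_op_sc D) {2}/GRing.scale /=.
  by rewrite of_opM of_op_sc -sclC betaZ mulrC rmorphM.
move=> A B g f gs.
have [gk gkE] := rscal_linear (scr D) g; have [fk fkE] := rscal_linear (scr D) f.
have [|th thE] := @vspace_projective k (rscal (scr D) (dual D E)) _ _ gk fk.
  by move=> y; have [x <-] := gs y; exists x; rewrite gkE.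
have thL a x y : th (scr D a *: (x : dual D E) + y) =
    scr D a *: (th x : A) + th y := linearP th a x y.
have thD (x y : dual D E) : th (x + y) = (th x : A) + th y by exact: linearD.
have thZ a (x : dual D E) : th (scr D a *: x) = scr D a *: (th x : A).
  by exact: (linearZ_LR th a x).
have compD j x y : comp j (x + y) = comp j x + comp j y.
  by have := compL j 1 x y; rewrite rmorph1 !scale1r.
have [|h hE] := @linear_of _ (dual D E) A
    (fun f => \sum_j to_op D (b j) *: (th (comp j f) : A)).
  move=> a x y.
  rewrite scaler_sumr.
  rewrite (eq_bigr (fun j => to_op D (b j) *: (th (comp j (a *: x)) : A) +
      to_op D (b j) *: (th (comp j y) : A))); last first.
    by move=> j _; rewrite compD thD scalerDr.
  rewrite big_split /=; congr (_ + _).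
  transitivity (\sum_j \sum_l (to_op D (b j) * scr D (beta j (b l * of_op D a))) *:
      (th (comp l x) : A)).
    apply: eq_bigr => j _.
    rewrite comp_act (big_morph th thD (linear0 th)) scaler_sumr.
    by apply: eq_bigr => l _; rewrite thZ scalerA.
  rewrite exchange_big /=; apply: eq_bigr => l _.
  rewrite -scaler_suml scalerA; congr (_ *: _).
  rewrite -[a in RHS](of_opK D) -to_opM [in RHS](dual_basis (b l * of_op D a)).
  rewrite (big_morph (to_op D) (@to_opD _ _ _ D) (_ : _ = 0)) => [|].
    by apply: eq_bigr => j _; rewrite to_opM to_op_sc.
  by rewrite -(rmorph0 (scl D)) to_op_sc rmorph0.
exists h => x; rewrite hE linear_sum [in RHS](comp_decomp x) linear_sum.
by apply: eq_bigr => j _; rewrite !linearZ /= -gkE thE fkE.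
Qed.

(** The modules in the injective resolution may have infinite dimension; only the
    algebra is finite-dimensional. *)
Lemma id_le_dual (n : nat) (M : lmodType R) : id_le n M -> pd_le n (dual D M).
Proof.
elim: n M => [|n IH] M; first exact: dual_injective.
move=> [E [C [i [p [ip Ei idC]]]]].
have [p' [i' pi']] := hom_short_exact D k^o ip.
exists (dual D C), (dual D E), p', i'; split=> //; last exact: IH.
exact: dual_injective.
Qed.
End DualInjective.

Lemma pd_le_dual (k : fieldType) (R R' : pzRingType) (D : opposite_pair k R R')
    (n : nat) (M : lmodType R) : pd_le n M -> id_le n (dual D M).
Proof.
elim: n M => [|n IH] M; first exact: dual_projective.
move=> [K [P [i [p [ip Pp pdK]]]]].
have [p' [i' pi']] := hom_short_exact D k^o ip.
exists (dual D P), (dual D K), p', i'; split=> //; last exact: IH.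
exact: dual_projective.
Qed.

(** * Coefficients in the path algebra *)

Lemma rmorphism_of (R R' : pzRingType) (f : R -> R') :
  {morph f : x y / x - y} -> f 1 = 1 -> {morph f : x y / x * y} ->
  exists h : {rmorphism R -> R'}, h =1 f.
Proof.
move=> fB f1 fM.
pose m1 := GRing.isZmodMorphism.Build R R' f fB.
pose m2 := GRing.isMonoidMorphism.Build R R' f (f1, fM).
pose h : {rmorphism R -> R'} := HB.pack f m1 m2.
by exists h.
Qed.

Section QuotProj.
Variables (R : pzRingType) (I : ideal R).

Fact quot_proj_zmod_morphism : {morph quot_proj I : x y / x - y}.
Proof. exact: raddfB. Qed.
HB.instance Definition _ := GRing.isZmodMorphism.Build R (quot_ring I)
  (quot_proj I) quot_proj_zmod_morphism.

Fact quot_proj_monoid_morphism :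
  (quot_proj I 1 = 1) * {morph quot_proj I : x y / x * y}.
Proof. by split=> // x y; rewrite -quot_projM. Qed.
HB.instance Definition _ := GRing.isMonoidMorphism.Build R (quot_ring I)
  (quot_proj I) quot_proj_monoid_morphism.

Lemma quot_proj0 x : x \in I -> quot_proj I x = 0.
Proof.
by move=> xI; apply/eqP; rewrite -(rmorph0 (quot_proj I)) quot_proj_eq subr0.
Qed.
End QuotProj.

Section PathAlgebra.
Variables (k : fieldType) (Q : quiver).
Local Notation kQ := (path_alg k Q).
Local Notation path_elt := (@path_elt k Q).
Implicit Types (f g : kQ) (p q : qpath Q).

Lemma path_coef_sum (T : Type) (s : seq T) (F : T -> kQ) p :
  coef (\sum_(i <- s) F i) p = \sum_(i <- s) coef (F i) p.
Proof. by apply: (big_morph (fun f => coef f p)). Qed.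

Lemma path_coefZ c f p : coef (c *: f) p = c * coef f p.
Proof. by []. Qed.

Lemma coef_mul f g p : coef (f * g) p =
  \sum_(j < (qlen p).+1) coef f (qtake j p) * coef g (qdrop j p).
Proof. by []. Qed.

Lemma path_scaleAl c f g : c *: (f * g) = (c *: f) * g.
Proof.
apply: path_algP => p; rewrite path_coefZ !coef_mul mulr_sumr.
by apply: eq_bigr => j _; rewrite path_coefZ mulrA.
Qed.

Lemma path_scaleAr c f g : c *: (f * g) = f * (c *: g).
Proof.
apply: path_algP => p; rewrite path_coefZ !coef_mul mulr_sumr.
by apply: eq_bigr => j _; rewrite path_coefZ mulrCA.
Qed.

Lemma coef_triv_mul f g i :
  coef (f * g) (qtriv i) = coef f (qtriv i) * coef g (qtriv i).
Proof.
by rewrite coef_mul big_ord1 qdrop0; congr (coef f _ * _); exact: qpathP.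
Qed.

Lemma coef_path_elt q p : coef (path_elt q) p = (p == q)%:R.
Proof. by []. Qed.

Lemma qtriv_inj : injective (@qtriv Q).
Proof. by move=> i j /(congr1 val)/= []. Qed.

Lemma coef_triv_path_mul i f p :
  coef (path_elt (qtriv i) * f) p = ((val p).1 == i)%:R * coef f p.
Proof.
rewrite coef_mul big_ord_recl big1 ?addr0 /= => [|j _].
  rewrite qdrop0 coef_path_elt; congr (_%:R * _); congr nat_of_bool.
  apply/eqP/eqP => [/(congr1 (fun p => (val p).1))//|pi].
  by apply: qpathP => //=; rewrite take0.
rewrite coef_path_elt; case: eqP => [e|_]; last by rewrite mul0r.
by have := congr1 (@qlen Q) e; rewrite qlen_take.
Qed.

Lemma triv_path_mul i j : path_elt (qtriv i) * path_elt (qtriv j) =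
  if i == j then path_elt (qtriv i) else 0.
Proof.
apply: path_algP => p; rewrite coef_triv_path_mul coef_path_elt.
case: (p =P qtriv j) => [->|pj] /=.
  rewrite mulr1 eq_sym; case: (i =P j) => [->|_] //.
  by rewrite coef_path_elt eqxx.
rewrite mulr0; case: eqP => [->|_] //; rewrite coef_path_elt.
by case: eqP pj.
Qed.

Lemma sum_triv_path : \sum_i path_elt (qtriv i) = 1.
Proof.
apply: path_algP => p; rewrite path_coef_sum.
have -> : coef (1 : kQ) p = (qlen p == 0%N)%:R by [].
case: eqP => [p0|p0].
  have -> : p = qtriv (val p).1 by apply: qpathP => //; exact: size0nil.
  rewrite (bigD1 (val p).1) //= coef_path_elt eqxx big1 ?addr0 // => j nj.
  by rewrite coef_path_elt (inj_eq qtriv_inj) eq_sym (negbTE nj).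
rewrite big1 // => j _; rewrite coef_path_elt.
by case: eqP => // e; case: p0; rewrite e.
Qed.

(** The function that reads the coefficients of [f] at the paths which begin with [a],
    indexed by what follows [a]. *)
Definition arrow_tail_fun (a : arrow Q) f (q : qpath Q) : k^o :=
  if (val q).1 == target a then
    oapp (coef f) 0 (insub (source a, a :: (val q).2))
  else 0.

Fact arrow_tail_finsupp a f : arrow_tail_fun a f \in @finsupp_pred k Q.
Proof.
have /asboolP[s hs] := valP f; apply/asboolP; exists [seq qdrop 1 p | p <- s] => q.
rewrite /arrow_tail_fun; case: ((val q).1 =P target a) => [qa|_]; last by rewrite eqxx.
case: insubP => [p _ pE|_] /=; last by rewrite eqxx.
move=> /hs ps; apply/mapP; exists p => //.
by apply: qpathP; rewrite /= pE /= ?drop0 ?take0.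
Qed.

Definition arrow_tail (a : arrow Q) f : kQ :=
  exist (fun h => h \in @finsupp_pred k Q) _ (arrow_tail_finsupp a f).

Lemma coef_arrow_mul a f p : coef (path_elt (qarrow a) * f) p =
  if qlen p == 0%N then 0 else (qtake 1 p == qarrow a)%:R * coef f (qdrop 1 p).
Proof.
have take_arrow j : (j <= qlen p)%N -> j <> 1%N -> qtake j p == qarrow a = false.
  move=> jp j1; apply/eqP => e; apply: j1.
  by have := congr1 (@qlen Q) e; rewrite qlen_take.
rewrite coef_mul; case: eqP => [p0|p0].
  by rewrite p0 big_ord1 coef_path_elt take_arrow // mul0r.
have p1 : (1 < (qlen p).+1)%N by rewrite ltnS lt0n; exact/eqP.
rewrite (bigD1 (Ordinal p1)) //= big1 ?addr0 ?coef_path_elt // => j nj.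
rewrite coef_path_elt take_arrow ?mul0r // -1?ltnS //.
by move=> j1; case/eqP: nj; apply: val_inj.
Qed.

(** A path of positive length factors uniquely through its first arrow. *)
Lemma arrow_decomp f : (forall i, coef f (qtriv i) = 0) ->
  f = \sum_a path_elt (qarrow a) * arrow_tail a f.
Proof.
move=> f0; apply: path_algP => p; rewrite path_coef_sum.
case: p => [[i [|b s]] ps].
  rewrite [exist _ _ _](_ : _ = qtriv i); last exact: qpathP.
  by rewrite f0 big1 // => a _; rewrite coef_arrow_mul.
set p := exist _ _ _; have /andP[/eqP bi bs] := ps.
rewrite (bigD1 b) //= big1 ?addr0 => [|a ab]; rewrite coef_arrow_mul /=.
  have -> : qtake 1 p = qarrow b by apply: qpathP; rewrite /= ?take0.
  rewrite eqxx mul1r /coef /= /arrow_tail_fun /= take0 eqxx drop0.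
  case: insubP => [q _ qE|] /=; last by case/negP; apply/andP; split.
  by congr (val f _); apply: val_inj; rewrite qE /= bi.
case: eqP => [e|_]; last by rewrite mul0r.
by case/eqP: ab; have := congr1 (fun q => (val q).2) e; rewrite /= take0 => -[].
Qed.

Lemma arrow_idealP f : @arrow_ideal k Q f <-> forall i, coef f (qtriv i) = 0.
Proof.
split=> [fA|f0 S arrS]; last first.
  rewrite (arrow_decomp f0); apply: rpred_sum => a _.
  by apply: ideal_mulr; exact: arrS.
pose P : {pred kQ} := fun f => [forall i, coef f (qtriv i) == 0].
have PP g : reflect (forall i, coef g (qtriv i) = 0) (g \in P).
  by apply: (iffP forallP) => h i; [apply/eqP/h | rewrite h].
have Pz : zmod_closed P.
  split=> [|g h /PP hg /PP hh]; apply/PP => i //.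
  have -> : coef (g - h) (qtriv i) = coef g (qtriv i) - coef h (qtriv i) by [].
  by rewrite hg hh subr0.
have Pl a : {in P, forall x, a * x \in P}.
  by move=> x /PP hx; apply/PP => i; rewrite coef_triv_mul hx mulr0.
have Pr a : {in P, forall x, x * a \in P}.
  by move=> x /PP hx; apply/PP => i; rewrite coef_triv_mul hx mul0r.
pose m1 := GRing.isZmodClosed.Build kQ P Pz.
pose m2 := isTwoSidedIdeal.Build kQ P Pl Pr.
pose P' : ideal kQ := HB.pack P m1 m2.
apply/PP; apply: (fA P') => a; apply/PP => i; rewrite coef_path_elt.
by case: eqP => // /(congr1 (@qlen Q)).
Qed.
End PathAlgebra.

(** * Bound quiver algebras are split basic and finite-dimensional *)

Section BoundQuiver.
Variables (k : fieldType) (Q : quiver) (I : ideal (path_alg k Q)).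
Hypothesis hI : admissible I.
Local Notation kQ := (path_alg k Q).
Local Notation L := (bound_quiver_alg I).
Local Notation pi := (quot_proj I).

(** An admissible ideal consists of combinations of paths of length at least two. *)
Lemma admissible_coef f i : f \in I -> coef f (qtriv i) = 0.
Proof.
have [m _ [_ I2]] := hI; move=> /I2; rewrite /pow_ideal /=.
apply: (@mul_set_ind _ kQ^o _ _ (fun f => coef f (qtriv i) = 0)) => //.
  by move=> x y xi yi; rewrite Defs.coefD xi yi addr0.
by move=> a x /arrow_idealP ai _; rewrite [LHS]coef_triv_mul ai mul0r.
Qed.

Lemma coef_repr f i : coef (repr (pi f)) (qtriv i) = coef f (qtriv i).
Proof.
have : repr (pi f) - f \in I by rewrite -quot_proj_eq quot_projK.
by move=> /(@admissible_coef _ i) e; apply/subr0_eq.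
Qed.

(** The characters read the coefficients at the trivial paths, which are well defined
    modulo an admissible ideal.  Their common kernel is the image of the arrow
    ideal, whence it is nilpotent and generated by the arrows as a right ideal. *)
Lemma bound_quiver_split_basic : exists S : split_basic k L (vertex Q),
  [/\ forall i, idem S i = vertex_idem I i,
      forall b, jacobson (pi (path_elt k (qarrow b)) : L)
    & forall a, jacobson a ->
        exists x : arrow Q -> L, a = \sum_b pi (path_elt k (qarrow b)) * x b].
Proof.
have [|||c cE] := @rmorphism_of k L (fun x => pi (x *: (1 : kQ))).
- by move=> x y; rewrite scalerBl rmorphB.
- by rewrite scale1r rmorph1.
- by move=> x y; rewrite -rmorphM -path_scaleAl mul1r scalerA.
have chi_ex i : exists h : {rmorphism L -> k}, forall f, h (pi f) = coef f (qtriv i).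
  have [|||h hE] := @rmorphism_of L k (fun a => coef (repr a) (qtriv i)).
  - by move=> a b; rewrite -[a]quot_projK -[b]quot_projK -rmorphB !coef_repr.
  - by rewrite -(rmorph1 pi) coef_repr.
  - move=> a b; rewrite -[a]quot_projK -[b]quot_projK -rmorphM !coef_repr.
    exact: coef_triv_mul.
  by exists h => f; rewrite hE coef_repr.
have [ch chE] := choice chi_ex.
have ch_arrow a : (forall i, ch i a = 0) -> forall i, coef (repr a) (qtriv i) = 0.
  by move=> a0 i; rewrite -chE quot_projK.
have [S SE] : exists S : split_basic k L (vertex Q),
    (forall i, idem S i = vertex_idem I i) /\ (forall i, chi S i = ch i); last first.
  have [iE chiE] := SE; exists S; split=> // [b|a /(jacobsonP S) Ja].
    apply/(jacobsonP S) => i; rewrite chiE chE coef_path_elt.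
    by case: eqP => // /(congr1 (@qlen Q)).
  exists (fun b => pi (arrow_tail b (repr a))).
  rewrite -[LHS]quot_projK {1}[repr a]arrow_decomp; last first.
    by apply: ch_arrow => i; rewrite -chiE.
  by rewrite rmorph_sum; apply: eq_bigr => b _; rewrite rmorphM.
have scC x (a : L) : c x * a = a * c x.
  rewrite cE -[a]quot_projK -!rmorphM -path_scaleAl -path_scaleAr.
  by rewrite mul1r mulr1.
have chi_sc i x : ch i (c x) = x.
  by rewrite cE chE path_coefZ -[RHS]mulr1.
have chi_idem i j : ch j (vertex_idem I i) = (i == j)%:R.
  by rewrite chE coef_path_elt (inj_eq (@qtriv_inj Q)) eq_sym.
have idemM i j : vertex_idem I i * vertex_idem I j =
    if i == j then vertex_idem I i else 0.
  by rewrite -rmorphM triv_path_mul; case: eqP => // _; rewrite rmorph0.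
have idem_sum : \sum_i vertex_idem I i = 1.
  by rewrite -rmorph_sum sum_triv_path rmorph1.
have pow_lift t a : pow_ideal [set b | forall i, ch i b = 0] t a ->
    exists2 f, pi f = a & pow_ideal (@arrow_ideal k Q) t f.
  elim: t a => [|t IH] a; first by exists (repr a) => //; exact: quot_projK.
  apply: (@mul_set_ind _ L^o _ _
    (fun a => exists2 f, pi f = a & pow_ideal (@arrow_ideal k Q) t.+1 f)).
  - by exists 0; [exact: rmorph0 | exact: mul_set0].
  - move=> _ _ [f <- hf] [g <- hg]; exists (f + g); first exact: rmorphD.
    exact: mul_setD.
  - move=> b _ b0 /IH[f <- hf]; exists (repr (b : L) * f).
      by rewrite [LHS]rmorphM; congr (_ * _); exact: quot_projK.
    by apply: (@mul_set_scale _ kQ^o) => //; apply/arrow_idealP/ch_arrow.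
have chi_nil : exists m, forall a,
    pow_ideal [set b | forall i, ch i b = 0] m a -> a = 0.
  have [m _ [mI _]] := hI; exists m => a /pow_lift[f <- hf].
  exact/quot_proj0/mI.
by exists (@SplitBasic k L (vertex Q) c scC ch chi_sc _ chi_idem idemM
  idem_sum chi_nil).
Qed.
End BoundQuiver.

Section DualBasis.
Variables (k : fieldType) (L : pzRingType) (V A : finType).
Variables (S : split_basic k L V) (arr : A -> L).
Local Notation sc := (sc S).
Hypothesis arrJ : forall b, jacobson (arr b).
Hypothesis arr_gen : forall a, jacobson a -> exists x : A -> L, a = \sum_b arr b * x b.

(** Modulo the t-th power of the radical the algebra is spanned by the products of
    fewer than t arrows, followed by an idempotent: split off the values of the
    characters, write the rest as a sum of arrows times elements, and expand
    these modulo the previous power. *)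
Lemma finite_span : exists (T : finType) (b : T -> L),
  forall a, exists c : T -> k, a = \sum_u sc (c u) * b u.
Proof.
suff span t : exists (T : finType) (b : T -> L), forall a, exists c : T -> k,
    pow_ideal (@jacobson L) t (a - \sum_u sc (c u) * b u).
  have [m nil] := jacobson_nil S; have [T [b bP]] := span m; exists T, b => a.
  by have [c /nil/subr0_eq] := bP a; exists c.
elim: t => [|t [T [b bP]]].
  by exists void, (fun=> 0) => a; exists (fun=> 0).
exists (V + A * T)%type, (fun w => match w with
  | inl i => idem S i | inr (j, u) => arr j * b u end) => a.
have [|x xE] := arr_gen (a := a - \sum_i sc (chi S i a) * idem S i).
  apply/(jacobsonP S) => j; rewrite rmorphB rmorph_sum (bigD1 j) //=.
  rewrite rmorphM chi_sc chi_idem eqxx mulr1 big1 ?addr0 ?subrr // => i ij.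
  by rewrite rmorphM chi_idem (negbTE ij) mulr0.
have [c cP] := choice (fun j => bP (x j)).
exists (fun w => match w with inl i => chi S i a | inr (j, u) => c j u end).
rewrite big_sumType /= opprD addrA xE.
rewrite [X in _ - X](_ : _ = \sum_j arr j * \sum_u sc (c j u) * b u); last first.
  under [RHS]eq_bigr do rewrite mulr_sumr.
  rewrite pair_bigA /=; apply: eq_bigr => -[j u] _ /=.
  by rewrite !mulrA scC.
rewrite -sumrB; apply: (big_ind (pow_ideal (@jacobson L) t.+1)).
- exact: mul_set0.
- by move=> y z; exact: mul_setD.
- move=> j _; rewrite -mulrBr; apply: (@mul_set_scale _ L^o); last exact: cP.
  exact: arrJ.
Qed.

(** A linear section of the surjection given by a finite spanning family; the family
    need not be free. *)
Lemma finite_dual_basis : exists (T : finType) (b : T -> L) (beta : T -> L -> k),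
  (forall u a x y, beta u (sc a * x + y) = a * beta u x + beta u y) /\
  (forall a, a = \sum_u sc (beta u a) * b u).
Proof.
have [T [b bP]] := finite_span.
have [|g gE] := @linear_of k {ffun T -> k^o} (rscal sc L^o)
    (fun c => \sum_u sc (c u) * b u).
  move=> a x y; rewrite scaler_sumr -big_split /=; apply: eq_bigr => u _.
  by rewrite !ffunE rmorphD mulrDl rmorphM rscalE -mulrA.
have [|s sE] := @vspace_projective k (rscal sc L^o) _ _ g idfun.
  move=> a; have [c cE] := bP a; exists [ffun u => c u].
  by rewrite gE [RHS]cE; apply: eq_bigr => u _; rewrite ffunE.
exists T, b, (fun u a => s a u); split=> [u a x y|a].
  by have /= /ffunP/(_ u) := linearP s a x y; rewrite !ffunE.
by have := sE a; rewrite gE.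
Qed.
End DualBasis.

(** * The simple modules and the projectives at the vertices *)

Lemma opposite_pair_of (k : fieldType) (L : pzRingType) (c : {rmorphism k -> L}) :
  (forall x a, c x * a = a * c x) ->
  exists D : opposite_pair k L L^c, scl D = c.
Proof.
move=> cC.
have [|||c' c'E] := @rmorphism_of k L^c c.
- exact: (rmorphB c).
- exact: (rmorph1 c).
- by move=> x y; rewrite mulrC; exact: (rmorphM c).
have to_opM (a b : L) : (a * b : L) = (b : L^c) * (a : L^c) by [].
by exists (@OppositePair k L L^c c c' id id (fun=> erefl) (fun=> erefl)
  (fun _ _ => erefl) to_opM (fun x => esym (c'E x)) cC).
Qed.

Section Simples.
Variables (k : fieldType) (L : pzRingType) (V : finType).
Variable S : split_basic k L V.
Local Notation sc := (sc S).
Local Notation chi := (chi S).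
Local Notation idem := (idem S).

Lemma detects_left_mul_top (P : pred V) j :
  P j -> detects S j (left_mul_top (\sum_(i | P i) idem i)).
Proof.
set f := \sum_(i | P i) _ => Pj.
have ef : idem j * f = idem j.
  rewrite mulr_sumr (bigD1 j) //= idemM eqxx big1 ?addr0 // => i /andP[_ ij].
  by rewrite idemM eq_sym (negbTE ij).
have [p [sp p0]] := quot_mod_linear (@jac_mul_pred L f).
split.
  move=> a x Ja; have [y <-] := sp x; rewrite -linearZ; apply/p0/asboolP.
  have /asboolP[b yb] := valP y; exists (a * b).
    by apply/(jacobsonP S) => i; rewrite rmorphM (chi_jacobson S i Ja) mul0r.
  by rewrite -mulrA -yb.
have ein : idem j \in left_mul_pred f by apply/asboolP; exists (idem j).
pose e : left_mul_mod f := exist (fun x => x \in left_mul_pred f) (idem j : L^o) ein.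
exists (p e).
  move=> /p0/asboolP[a Ja /= ea].
  have := congr1 (chi j) ea; rewrite rmorphM (chi_jacobson S j Ja) mul0r.
  by rewrite chi_idem eqxx => /eqP; rewrite oner_eq0.
rewrite -linearZ; congr (p _); apply: val_inj => /=.
by rewrite /GRing.scale /= idemM eqxx.
Qed.

Section Vertex.
Variable j : V.
Local Notation P := (left_mul_mod (idem j)).

Fact vertex_gen_in : idem j \in left_mul_pred (idem j).
Proof. by apply/asboolP; exists 1; rewrite mul1r. Qed.

Definition vertex_gen : P :=
  exist (fun x => x \in left_mul_pred (idem j)) (idem j : L^o) vertex_gen_in.

Lemma vertex_genE (x : P) : x = (val x : L) *: vertex_gen.
Proof.
apply: val_inj; rewrite /= /GRing.scale /=.
by have /asboolP[b ->] := valP x; rewrite -mulrA idemM eqxx.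
Qed.

Lemma left_mul_mod_projective : projective P.
Proof.
move=> A B g f gs; have [a ga] := gs (f vertex_gen).
have [|h hE] := @linear_of _ P A (fun x => (val x : L) *: a).
  by move=> c x y; rewrite /= scalerDl scalerA.
by exists h => x; rewrite hE linearZ /= ga -linearZ -vertex_genE.
Qed.

Lemma top_detects : detects S j (top_mod P).
Proof.
split; first exact: top_killed.
have [p [sp p0]] := quot_mod_linear (@rad_pred L P).
exists (p vertex_gen).
  move=> /p0/rad_predP Je.
  have : chi j (val vertex_gen) = 0.
    move: Je; apply: (@mul_set_ind _ P _ _ (fun x => chi j (val x) = 0)).
    - exact: rmorph0.
    - by move=> x y hx hy; rewrite rmorphD hx hy addr0.
    - by move=> a x /(chi_jacobson S j) a0 _; rewrite rmorphM a0 mul0r.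
  by rewrite chi_idem eqxx => /eqP; rewrite oner_eq0.
by rewrite -linearZ; congr (p _); rewrite [RHS]vertex_genE.
Qed.

(** The top is the line spanned by the class of the generator, whose dual is therefore
    cyclic. *)
Lemma top_line : exists s : top_mod P, forall x, exists t, x = sc t *: s.
Proof.
have [p [sp p0]] := quot_mod_linear (@rad_pred L P).
exists (p vertex_gen) => x; have [y <-] := sp x; exists (chi j (val y)).
have eg : vertex_gen = idem j *: vertex_gen by rewrite [LHS]vertex_genE.
rewrite {1}[y]vertex_genE linearZ /= eg linearZ /=.
by rewrite (act_idem S (@top_killed _ P)).
Qed.

(** The projective is local: a summand that contains an element with nonzero
    character at [j] contains the generator up to the radical, and by nilpotency
    contains the generator. *)
Lemma left_mul_mod_indecomposable : indecomposable P.
Proof.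
split.
  move=> /(_ vertex_gen)/(congr1 (fun x : P => chi j (val x))).
  by rewrite rmorph0 chi_idem eqxx => /eqP; rewrite oner_eq0.
have full (U U' : submodClosed P) u :
    (forall x, x \in U -> x \in U' -> x = 0) -> u \in U -> chi j (val u) != 0 ->
    forall x, x \in U' -> x = 0.
  move=> UU' uU u0.
  (* The generator is w + n ^+ t times itself with w in U, and n is nilpotent. *)
  pose n := vertex_gen - sc (chi j (val u))^-1 *: u.
  have nJ i : chi i (val n) = 0.
    have -> : val n = val n * idem j by have := congr1 val (vertex_genE n).
    rewrite rmorphM chi_idem eq_sym; case: eqP => [->|_]; last by rewrite mulr0.
    have -> : val n = idem j - sc (chi j (val u))^-1 * (val u : L) by [].
    by rewrite rmorphB rmorphM chi_sc chi_idem eqxx mulVf // subrr mul0r.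
  have [m nil] := chi_nil S.
  have genU t : exists2 w, w \in U & vertex_gen - w = (val n : L) ^+ t *: vertex_gen.
    elim: t => [|t [w wU wE]].
      by exists 0; [exact: rpred0 | rewrite subr0 expr0 scale1r].
    exists (w + (val n : L) ^+ t *: (sc (chi j (val u))^-1 *: u)).
      by rewrite rpredD // !rpredZ.
    by rewrite opprD addrA wE -scalerBr -/n {2}[n]vertex_genE scalerA exprSr.
  have [w wU] := genU m; rewrite (nil _ (pow_ideal_expr _ nJ)) scale0r => /subr0_eq gw.
  by move=> x xU'; apply: UU' xU'; rewrite [x]vertex_genE gw; exact: rpredZ.
move=> U U' UU' sum; have [u [v [uU vV uv]]] := sum vertex_gen.
have : chi j (val u) + chi j (val v) = 1.
  have := congr1 (fun x : P => chi j (val x)) uv.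
  by rewrite chi_idem eqxx rmorphD.
case: (eqVneq (chi j (val u)) 0) => [-> | u0 _].
  rewrite add0r => v1; left; apply: (full U' U v) => //.
    by move=> x ? ?; exact: UU'.
  by rewrite v1 oner_eq0.
by right; apply: full uU u0.
Qed.
End Vertex.
End Simples.

(** * The bounds on the finitistic dimension *)

Section MainBounds.
Variables (k : fieldType) (L : pzRingType) (V A : finType).
Variables (S : split_basic k L V) (arr : A -> L).
Hypothesis arrJ : forall b, jacobson (arr b).
Hypothesis arr_gen : forall a, jacobson a -> exists x : A -> L, a = \sum_b arr b * x b.

Lemma big_findim_le_injdim :
  le_enat (big_findim L)
    (injdim (left_mul_top (\sum_(j | `[< non_maximal S j >]) idem S j))).
Proof.
set T := left_mul_top _; case e : (injdim T) => [d|]; last by case: big_findim.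
have [/inj_resolution_id_le idT _] := least_Some e.
apply: (big_findim_le (S := S)) => j nm; exists T; last by exists d.
by apply: detects_left_mul_top; exact/asboolP.
Qed.

Hypothesis quasi : quasi_uniform_loewy_length L.

Lemma non_maximal_id_le j : non_maximal S j ->
  exists n, id_le n (top_mod (left_mul_mod (idem S j))).
Proof.
move=> nm; have [n /inj_resolution_id_le idn] :
    exists n, has_inj_resolution (top_mod (left_mul_mod (idem S j))) n.
  apply: least_neq_None => id_inf; apply: nm; apply: quasi id_inf.
    exact: left_mul_mod_projective.
  exact: left_mul_mod_indecomposable.
by exists n.
Qed.

Lemma big_findim_finite : big_findim L <> None.
Proof.
have /choice[n nP] : forall j, exists n, non_maximal S j ->
    id_le n (top_mod (left_mul_mod (idem S j))).
  move=> j; have [/non_maximal_id_le[n idn]|nm] := pselect (non_maximal S j).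
    by exists n.
  by exists 0%N.
have : le_enat (big_findim L) (Some (\max_j n j)).
  apply: (big_findim_le (S := S)) => j nm.
  exists (top_mod (left_mul_mod (idem S j))); first exact: top_detects.
  by exists (n j); [exact: leq_bigmax | exact: nP].
by case: big_findim.
Qed.

Lemma dual_finitely_generated (D : opposite_pair k L L^c) (M : lmodType L) (s : M) :
  (forall x, exists t, x = scl D t *: s) -> finitely_generated (dual D M).
Proof.
move=> line.
have [s0|s0] := pselect (s = 0).
  exists 0%N, (fun=> 0) => f; exists (fun=> 0); rewrite big_ord0.
  apply: hom_ext => x; have [t ->] := line x.
  by rewrite s0 scaler0 !hom_appr0.
have [g gs] := @functional_neq0 k (rscal (scl D) M) s s0.
have [h hE] := linear_hom g.
exists 1%N, (fun=> h) => f; exists (fun=> scr D (hom_app f s)).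
rewrite big_ord1; apply: hom_ext => x; have [t ->] := line x.
rewrite hom_appZ of_op_sc !hom_apprZ hE gs.
by rewrite /GRing.scale /= mulr1 mulrC.
Qed.

Lemma big_findim_le_small_opp : le_enat (big_findim L) (small_findim L^c).
Proof.
case e : (small_findim L^c) => [d|]; last by case: big_findim.
have [dP _] := least_Some e.
have [D Dsc] := opposite_pair_of (@scC _ _ _ S).
have [I [b [beta [betaP dual_basis]]]] := finite_dual_basis S arrJ arr_gen.
rewrite -Dsc in betaP dual_basis.
apply: (big_findim_le (S := S)) => j nm.
have [n idn] := non_maximal_id_le nm; set T := top_mod _ in idn.
have fgT : finitely_generated (dual D T).
  have [s sline] := top_line S j; apply: (@dual_finitely_generated _ _ s).
  by rewrite Dsc.
have /proj_resolutionP pdn := id_le_dual betaP dual_basis idn.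
have := dP _ fgT; have := le_enat_least pdn; rewrite -/(projdim _).
case pdE : (projdim (dual D T)) => [d'|] // _ d'd.
have [/proj_resolutionP/(pd_le_dual (flip D)) idTT _] := least_Some pdE.
have [JT [s s0 es]] := top_detects S j.
have [eta eta_inj] := bidual D T.
exists (dual (flip D) (dual D T)).
  split.
    move=> a x Ja; apply: hom_ext => f; rewrite hom_appZ.
    have -> : of_op (flip D) a *: f = 0; last by rewrite hom_appr0.
    by apply: hom_ext => y; rewrite hom_appZ to_opK JT // hom_appr0.
  exists (eta s); first by move=> eta0; apply: s0; apply: eta_inj; rewrite eta0 linear0.
  by rewrite -linearZ /= es.
by exists d' => //; exact: d'd.
Qed.
End MainBounds.

Theorem theorem4p12 (k : fieldType) (Q : quiver) (I : ideal (path_alg k Q))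
    (hI : admissible I) :
  let L := bound_quiver_alg I in
  le_enat (big_findim L) (injdim (left_mul_top (f_nm I))) /\
  (quasi_uniform_loewy_length L ->
     big_findim L <> None /\ le_enat (big_findim L) (small_findim L^c)).
Proof.
move=> L; have [S [idE arrJ arr_gen]] := bound_quiver_split_basic hI.
split=> [|quasi].
  have -> : f_nm I = \sum_(j | `[< non_maximal S j >]) idem S j.
    by apply: eq_big => i; rewrite ?/non_maximal idE.
  exact: big_findim_le_injdim.
split; first exact: (big_findim_finite S quasi).
exact: (big_findim_le_small_opp S arrJ arr_gen quasi).
Qed.
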